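(* For all integers $n\ge 1$ and $m\ge 0$, the (images in $\mathcal Q_m(n)$ of the) elements of the set $\mathcal B_m(n)$ form a basis of the $\mathbb F_q$-vector space of invariants $\mathcal Q_m(n)^{\mathrm B_n}$.
   Context: Let $q$ be a power of a prime and $\mathbb F_q$ the field with $q$ elements. $\mathrm{GL}_n=\mathrm{GL}_n(\mathbb F_q)$ acts on $\mathbb F_q[x_1,\ldots,x_n]$ by $\sigma f(x_1,\ldots,x_n)=f(\sigma x_1,\ldots,\sigma x_n)$, where $\sigma x_j=\sum_{i=1}^n\sigma_{ij}x_i$. This induces an action on $\mathcal Q_m(n)=\mathbb F_q[x_1,\ldots,x_n]/(x_1^{q^m},\ldots,x_n^{q^m})$. $\mathrm B_n\subset \mathrm{GL}_n$ is the Borel subgroup of invertible upper triangular matrices. For an integer $a\ge 0$ let $[a]_q=\frac{q^a-1}{q-1}$. For integers $a\ge1$, $b\ge 0$, $c\ge 0$ with $a\le c+1$, the operator $\delta_{a;b}\colon \mathbb F_q(x_1,\ldots,x_c)\to\mathbb F_q(x_1,\ldots,x_{c+1})$ sends $f$ to $N/L_a$, where $L_a=\det(x_j^{q^{i-1}})_{1\le i,j\le a}$ and $N$ is the $a\times a$ determinant whose $i$-th row, for $1\le i\le a-1$, is $(x_1^{q^{i-1}},\ldots,x_a^{q^{i-1}})$, and whose last row has $j$-th entry $x_j^{q^b}f(x_1,\ldots,\widehat{x_j},\ldots,x_{c+1})$ (hat means omitted), $1\le j\le a$. In particular $\delta_{1;b}(f)=x_1^{q^b-1}f(x_2,\ldots,x_{c+1})$.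 Put $D_a=\delta_{a;a}(1)\in\mathbb F_q[x_1,\ldots,x_a]$, where $1$ is regarded as a function of $a-1$ variables; thus $D_1=x_1^{q-1}$. For sequences $I=(i_1,\ldots,i_k)$, $J=(j_1,\ldots,j_k)$ of non-negative integers ($k\ge1$), put $$Y_b(I;J)=\delta_{1;b}^{i_1}\bigl(D_1^{j_1}\,\delta_{2;b}^{i_2}\bigl(D_2^{j_2}(\cdots(\delta_{k;b}^{i_k}(D_k^{j_k}))\cdots)\bigr)\bigr),$$ a function of $k+i_1+\cdots+i_k$ variables, where $D_a$ always denotes the function of the first $a$ variables and exponents on $\delta$ denote iteration. Every $Y_b(I;J)$ is a polynomial. Define $\Phi Y_b(I;J)=Y_{b+1}(0,I;0,J)$, i.e. $\Phi Y_b(I;J)=\delta_{2;b+1}^{i_1}(D_2^{j_1}\delta_{3;b+1}^{i_2}(D_3^{j_2}(\cdots(\delta_{k+1;b+1}^{i_k}(D_{k+1}^{j_k}))\cdots)))$. The sets $\mathcal B_m(n)$, $n\ge1$, $m\ge 0$, whose elements are polynomials of the form $Y_m(I;J)$ in $n$ variables, are defined inductively by: $\mathcal B_0(n)=\{1\}$ for all $n\ge1$ (with $1=Y_0(n-1;0)$); $\mathcal B_m(1)=\{D_1^a\mid 0\le a\le [m]_q\}$ for all $m\ge0$; and for $n\ge2$, $m\ge1$, $$\mathcal B_m(n)=\{\delta_{1;m}(Y)\mid Y\in\mathcal B_m(n-1)\}\sqcup\{D_1^a\,\Phi(Y)\mid 0\le a<[m]_q,\ Y\in\mathcal B_{m-1}(n-1)\},$$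 where $\Phi$ is applied to $Y$ written as $Y_{m-1}(I;J)$. *)

(* Defs.v *)
From HB Require Import structures.
From mathcomp Require Import all_boot all_order all_fingroup all_algebra all_field.
From mathcomp Require Import generic_quotient ring_quotient fraction.
From mathcomp.classical Require Import boolp.
From mathcomp.classical Require classical_sets.
From mathcomp.multinomials Require Import mpoly.

Set Implicit Arguments.
Unset Strict Implicit.
Unset Printing Implicit Defensive.

Import GRing.Theory.

Local Open Scope ring_scope.
Local Open Scope quotient_scope.

Section TruncatedPolynomials.
Variables (F : finFieldType) (m n : nat).

Local Notation q := #|F|.

Definition trunc_ideal : {pred {mpoly F[n]}} := fun p =>
  `[< exists g : 'I_n -> {mpoly F[n]}, p = \sum_i g i * 'X_i ^+ (q ^ m) >].

Lemma expq_gt0 : (0 < q ^ m)%N.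
Proof. by rewrite expn_gt0 (ltnW (finNzRing_gt1 F)). Qed.

Lemma trunc_ideal_closed : idealr_closed trunc_ideal.
Proof.
split.
- apply/asboolP; exists (fun=> 0); rewrite big1 // => i _; exact: mul0r.
- apply/asboolP => -[g /(congr1 (meval (fun=> 0)))].
  rewrite rmorph1 rmorph_sum big1 => [/eqP|i _]; first by rewrite oner_eq0.
  by rewrite rmorphM rmorphXn /= mevalXU expr0n eqn0Ngt expq_gt0 mulr0.
- move=> a u v /asboolP [g ->] /asboolP [h ->]; apply/asboolP.
  exists (fun i => a * g i + h i); rewrite mulr_sumr -big_split /=.
  by apply: eq_bigr => i _; rewrite mulrDl mulrA.
Qed.

HB.instance Definition _ := isIdealr.Build _ trunc_ideal trunc_ideal_closed.

Lemma trunc_idealX i : 'X_i ^+ (q ^ m) \in trunc_ideal.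
Proof.
apply/asboolP; exists (fun j => (j == i)%:R).
rewrite (bigD1 i) //= eqxx mul1r big1 ?addr0 // => j /negPf ->.
by rewrite mul0r.
Qed.

Definition tmon (e : {ffun 'I_n -> 'I_(q ^ m)}) : 'X_{1..n} :=
  [multinom (e i : nat) | i < n].

Lemma tmon_inj : injective tmon.
Proof.
move=> e f /mnmP ef; apply/ffunP => i; apply: val_inj.
by have := ef i; rewrite !mnmE.
Qed.

Lemma trunc_idealP (p : {mpoly F[n]}) :
  reflect (forall e, p@_(tmon e) = 0) (p \in trunc_ideal).
Proof.
apply: (iffP idP) => [/asboolP [g ->] e|p0].
  rewrite raddf_sum /= big1 // => i _; apply/eqP; rewrite mcoeff_eq0.
  rewrite mpolyXn (perm_mem (msuppMX _ _)); apply/mapP => -[k _ /mnmP /(_ i)].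
  rewrite mnmE mnmDE mulmnE mnm1E eqxx mul1n => ei.
  by have := ltn_ord (e i); rewrite ei ltnNge leq_addr.
rewrite (mpolyE p) big_seq; apply: rpred_sum => k.
rewrite -mul_mpolyC mcoeff_msupp => pk0; apply: idealMr.
have [k_lt|] := boolP [forall i, k i < q ^ m]%N.
  have := p0 [ffun i => Ordinal (forallP k_lt i)].
  rewrite (_ : tmon _ = k) => [pk|]; first by rewrite pk eqxx in pk0.
  by apply/mnmP => i; rewrite mnmE ffunE.
rewrite negb_forall => /existsP [i]; rewrite -leqNgt => ki.
have /submK <- : (U_(i) *+ (q ^ m) <= k)%MM.
  apply/mnm_lepP => j; rewrite mulmnE mnm1E.
  by case: eqP => [<-|_]; rewrite ?mul1n.
by rewrite mpolyXD -mpolyXn; apply/idealMr/trunc_idealX.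
Qed.

(* Q_m(n) = F_q[x_1, .., x_n] / (x_1 ^ (q ^ m), .., x_n ^ (q ^ m)) *)
Definition trunc_ring := {ideal_quot trunc_ideal}.

HB.instance Definition _ := GRing.ComNzRing.on trunc_ring.
HB.instance Definition _ := NzRingQuotient.on trunc_ring.

Local Notation Q := trunc_ring.

Definition trunc_scale (a : F) (x : Q) : Q := \pi_Q a%:MP * x.

Fact trunc_scaleA a b v :
  trunc_scale a (trunc_scale b v) = trunc_scale (a * b) v.
Proof. by rewrite /trunc_scale mulrA -rmorphM -mpolyCM. Qed.
Fact trunc_scale1 : left_id 1 trunc_scale.
Proof. by move=> v; rewrite /trunc_scale rmorph1 mul1r. Qed.
Fact trunc_scaleDr : right_distributive trunc_scale +%R.
Proof. by move=> a u v; rewrite /trunc_scale mulrDr. Qed.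
Fact trunc_scaleDl v : {morph trunc_scale^~ v : a b / a + b}.
Proof. by move=> a b; rewrite /trunc_scale mpolyCD rmorphD mulrDl. Qed.

HB.instance Definition _ := GRing.Zmodule_isLmodule.Build F Q
  trunc_scaleA trunc_scale1 trunc_scaleDr trunc_scaleDl.

Lemma pi_truncZ a p : \pi_Q (a *: p) = a *: \pi_Q p.
Proof. by rewrite -mul_mpolyC rmorphM. Qed.

Lemma pi_trunc_eq p r : reflect (\pi_Q p = \pi_Q r) (p - r \in trunc_ideal).
Proof. by rewrite Quotient.idealrBE; apply: eqP. Qed.

Lemma coef_repr p e : (repr (\pi_Q p))@_(tmon e) = p@_(tmon e).
Proof.
apply/eqP; rewrite -subr_eq0 -mcoeffB; apply/eqP.
by move: e; apply/trunc_idealP/pi_trunc_eq; rewrite reprK.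
Qed.

Fact trunc_vect_iso : Vector.axiom #|{ffun 'I_n -> 'I_(q ^ m)}| Q.
Proof.
exists (fun x => \row_k (repr x)@_(tmon (enum_val k))) => [a x y|].
  apply/rowP => k; rewrite !mxE -[x]reprK -[y]reprK -pi_truncZ -rmorphD.
  by rewrite !coef_repr mcoeffD mcoeffZ.
pose g (v : 'rV[F]_#|{ffun 'I_n -> 'I_(q ^ m)}|) : {mpoly F[n]} :=
  \sum_k v 0 k *: 'X_[tmon (enum_val k)].
have gE v k : (g v)@_(tmon (enum_val k)) = v 0 k.
  rewrite raddf_sum (bigD1 k) //= mcoeffZ mcoeffX eqxx mulr1 big1 ?addr0 //.
  move=> l lk; rewrite mcoeffZ mcoeffX (inj_eq tmon_inj) (inj_eq enum_val_inj).
  by rewrite (negPf lk) mulr0.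
exists (fun v => \pi_Q (g v)) => [x|v].
  rewrite -[RHS]reprK; apply/pi_trunc_eq/trunc_idealP => e.
  by rewrite -(enum_rankK e) mcoeffB gE mxE subrr.
by apply/rowP => k; rewrite mxE coef_repr gE.
Qed.

HB.instance Definition _ := Lmodule_hasFinDim.Build F Q trunc_vect_iso.

(* The substitution x_j |-> \sum_i s_ij x_i. *)
Definition mx_act (s : 'M[F]_n) (p : {mpoly F[n]}) : {mpoly F[n]} :=
  p \mPo [tuple \sum_i s i j *: 'X_i | j < n].

Lemma mx_act_ideal s p : p \in trunc_ideal -> mx_act s p \in trunc_ideal.
Proof.
have [r r_pr charF] := finPcharP F.
have charP : [pchar {mpoly F[n]}].-nat (q ^ m)%N.
  have rP : r \in [pchar {mpoly F[n]}] by rewrite pchar_lalg.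
  by rewrite pnatX (eq_pnat _ (pcharf_eq rP)) (card_pprimeChar charF) pnatX pnat_id.
move=> /asboolP [g ->]; rewrite /mx_act raddf_sum rpred_sum // => i _ /=.
rewrite rmorphM rmorphXn /= comp_mpolyXU -tnth_nth tnth_mktuple.
apply: idealMr; elim/big_rec: _ => [|j x _ IH].
  by rewrite expr0n eqn0Ngt expq_gt0 rpred0.
rewrite exprDn_pchar // rpredD // exprZn -mul_mpolyC.
exact/idealMr/trunc_idealX.
Qed.

Definition trunc_act (s : 'M[F]_n) (x : Q) : Q := \pi_Q (mx_act s (repr x)).

Lemma trunc_act_pi s p : trunc_act s (\pi_Q p) = \pi_Q (mx_act s p).
Proof.
apply/pi_trunc_eq; rewrite -raddfB; apply: mx_act_ideal.
by apply/pi_trunc_eq; rewrite reprK.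
Qed.

Fact trunc_act_linear s : linear (trunc_act s).
Proof.
move=> a x y; rewrite -[x]reprK -[y]reprK -pi_truncZ -rmorphD.
by rewrite !trunc_act_pi /mx_act comp_mpolyD comp_mpolyZ rmorphD /= pi_truncZ.
Qed.

HB.instance Definition _ s := GRing.isLinear.Build F Q Q _ (trunc_act s)
  (trunc_act_linear s).

Definition borel : {set 'M[F]_n} :=
  [set s : 'M[F]_n | (s \in unitmx) &&
    [forall i : 'I_n, forall j : 'I_n, (j < i)%N ==> (s i j == 0)]].

Definition borel_invariants : {vspace Q} :=
  (\bigcap_(s in borel) fixedSpace (linfun (trunc_act s)))%VS.

Lemma borel_invariantsP (x : Q) :
  reflect {in borel, forall s, trunc_act s x = x} (x \in borel_invariants).
Proof.
rewrite memvE; apply: (iffP subv_bigcapP) => inv s /inv.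
  by rewrite -memvE => /fixedSpaceP; rewrite lfunE.
by move=> fx; rewrite -memvE; apply/fixedSpaceP; rewrite lfunE.
Qed.

End TruncatedPolynomials.

Section Operators.
Variable F : finFieldType.

Local Notation q := #|F|.
Local Notation "p %:F" := (FracField.tofrac p).

Definition ratfun c := {fraction {mpoly F[c]}}.

HB.instance Definition _ c := GRing.Field.on (ratfun c).

Definition poly_omit c (j : 'I_c.+1) (p : {mpoly F[c]}) : {mpoly F[c.+1]} :=
  p \mPo [tuple 'X_(lift j i) | i < c].

(* The substitution f(x_1, .., x_c) |-> f(x_1, .., ^x_j, .., x_(c+1)), which is
   injective on polynomials, computed on a chosen numerator and denominator;
   omit_frac shows that the choice is irrelevant. *)
Definition omit c (j : 'I_c.+1) (f : ratfun c) : ratfun c.+1 :=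
  (poly_omit j \n_(repr f))%:F / (poly_omit j \d_(repr f))%:F.

Lemma poly_omit_inj c (j : 'I_c.+1) : injective (poly_omit j).
Proof.
pose t := [tuple if unlift j k is Some i then 'X_i else 0 : {mpoly F[c]} | k < c.+1].
apply: (can_inj (g := comp_mpoly t)) => p.
rewrite [in RHS](mpolyE p) [poly_omit j p]comp_mpolyE raddf_sum.
apply: eq_bigr => k _ /=.
rewrite comp_mpolyZ rmorph_prod mpolyXE_id; congr (_ *: _).
apply: eq_bigr => i _; rewrite tnth_mktuple rmorphXn /= comp_mpolyXU.
by rewrite -tnth_nth tnth_mktuple liftK.
Qed.

Lemma frac_numden c (f : ratfun c) :
  f = (\n_(repr f))%:F / (\d_(repr f))%:F.
Proof.
apply: (canRL (mulfK _)); first by rewrite tofrac_eq0 denom_ratioP.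
rewrite -{1}[f]reprK; unlock FracField.tofrac; rewrite -[LHS]FracField.pi_mul.
apply/eqmodP; rewrite /= FracField.equivfE /FracField.mulf.
rewrite !numden_Ratio ?mulf_neq0 ?oner_neq0 ?denom_ratioP //.
by rewrite !mulr1 mulrC.
Qed.

Lemma omit_frac c (j : 'I_c.+1) (p r : {mpoly F[c]}) : r != 0 ->
  omit j (p%:F / r%:F) = (poly_omit j p)%:F / (poly_omit j r)%:F.
Proof.
have nz (s : {mpoly F[c]}) : s != 0 -> (poly_omit j s)%:F != 0.
  rewrite tofrac_eq0; apply: contraNneq => s0.
  by apply/eqP/(@poly_omit_inj _ j); rewrite s0 /poly_omit rmorph0.
move=> r0; have /eqP := frac_numden (p%:F / r%:F); rewrite /omit.
set u := \n_ _; set v := \d_ _; have v0 : v != 0 by apply: denom_ratioP.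
rewrite !eqr_div ?tofrac_eq0 // -!rmorphM tofrac_eq => /eqP.
move/(congr1 (poly_omit j)); rewrite /poly_omit !rmorphM /= => e.
apply/eqP; rewrite eqr_div; try exact: nz.
by rewrite -!tofracM tofrac_eq /poly_omit e.
Qed.

Definition rvar c (j : 'I_c) : ratfun c := ('X_j)%:F.

(* Rows, columns and variables are numbered from 0. The operators are only
   meaningful for 1 <= a <= c.+1; then inord j below is the j-th variable. *)
Definition moore c a : 'M[ratfun c.+1]_a :=
  \matrix_(i < a, j < a) rvar (inord j) ^+ (q ^ i).

Definition delta_mx a b c (f : ratfun c) : 'M[ratfun c.+1]_a :=
  \matrix_(i < a, j < a)
    if (i.+1 < a)%N then rvar (inord j) ^+ (q ^ i)
    else rvar (inord j) ^+ (q ^ b) * omit (inord j) f.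

Definition delta a b c (f : ratfun c) : ratfun c.+1 :=
  \det (delta_mx a b f) / \det (moore c a).

(* A rational function in x_1, .., x_k is also one in x_1, .., x_c for c >= k.
   A ratfam gives its value in each ring of rational functions; its value for
   c < k is junk. Thus Dfam a c is D_a in F(x_1, .., x_c) for c >= a, and
   Y b IJ c is Y_b(I; J) for c = k + i_1 + .. + i_k. In computing the latter
   each delta_{a;b} is applied exactly in the number of variables it has in
   the definition of Y_b(I; J). *)
Definition ratfam := forall c, ratfun c.

Definition Delta a b (f : ratfam) : ratfam :=
  fun c => if c is c'.+1 then delta a b (f c') else 0.

Definition Dfam a : ratfam := Delta a a (fun=> 1).

(* A pair of sequences I, J of length k is given as [:: (i_1, j_1); ..; (i_k, j_k)];
   Yrec b a is the part of the nested expression that starts at delta_{a;b}. *)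
Fixpoint Yrec b a (IJ : seq (nat * nat)) : ratfam :=
  if IJ is (i, j) :: IJ' then
    iter i (Delta a b) (fun c => Dfam a c ^+ j * Yrec b a.+1 IJ' c)
  else fun=> 1.

Definition Y b (IJ : seq (nat * nat)) : ratfam := Yrec b 1 IJ.

Lemma delta1E b c (f : ratfun c) :
  delta 1 b f = rvar ord0 ^+ (q ^ b).-1 * omit ord0 f.
Proof.
have x0 : rvar (ord0 : 'I_c.+1) != 0.
  rewrite tofrac_eq0; apply/eqP => /(congr1 (meval (fun=> 1)))/eqP.
  by rewrite mevalXU rmorph0 oner_eq0.
rewrite /delta !det_mx11 !mxE /= expr1.
have -> : inord 0 = ord0 :> 'I_c.+1 by apply: ord_inj; rewrite inordK.
have qb : (0 < q ^ b)%N by rewrite expn_gt0 (ltnW (finNzRing_gt1 F)).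
by rewrite -{1}(prednK qb) exprSr mulrAC mulfK.
Qed.

Definition Phi b (IJ : seq (nat * nat)) : ratfam := Y b.+1 ((0, 0) :: IJ)%N.

Lemma delta1_Y b i j IJ c :
  delta 1 b (Y b ((i, j) :: IJ) c) = Y b ((i.+1, j) :: IJ) c.+1.
Proof. by []. Qed.

Lemma D1_Phi b a IJ c :
  Dfam 1 c ^+ a * Phi b IJ c = Y b.+1 ((0%N, a) :: IJ) c.
Proof. by rewrite /Phi /Y /= expr0 mul1r. Qed.

Lemma D1E c : Dfam 1 c.+1 = rvar ord0 ^+ q.-1.
Proof.
rewrite /Dfam /Delta delta1E expn1 [X in omit _ X](_ : _ = 1%:F / 1%:F).
  by rewrite omit_frac ?oner_eq0 // /poly_omit rmorph1 divr1 mulr1.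
by rewrite divr1.
Qed.

(* The polynomial equal to f, or 0 if f is not a polynomial. *)
Definition polyof c (f : ratfun c) : {mpoly F[c]} :=
  classical_sets.xget 0 (fun p => p%:F = f).

Lemma polyofK c (p : {mpoly F[c]}) : polyof p%:F = p.
Proof.
apply: classical_sets.xget_unique => // r /eqP.
by rewrite tofrac_eq => /eqP.
Qed.

End Operators.

Definition qbracket (q a : nat) : nat := ((q ^ a).-1 %/ q.-1)%N.

(* The operations on indices that correspond to Y |-> delta_{1;m}(Y) (see
   delta1_Y) and to Y |-> D_1^a Phi(Y) (see D1_Phi). *)
Definition delta1_idx (IJ : seq (nat * nat)) : seq (nat * nat) :=
  if IJ is (i, j) :: IJ' then (i.+1, j) :: IJ' else [::].

Definition D1_Phi_idx (a : nat) (IJ : seq (nat * nat)) : seq (nat * nat) :=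
  (0%N, a) :: IJ.

(* The indices (I; J) of the elements Y_m(I; J) of B_m(n); the case n = 0 is junk. *)
Fixpoint calB_idx (q m n : nat) {struct n} : seq (seq (nat * nat)) :=
  (if n is n'.+1 then
     if m is m'.+1 then
       if n' is 0 then [seq [:: (0, a)] | a <- iota 0 (qbracket q m).+1]
       else [seq delta1_idx IJ | IJ <- calB_idx q m n'] ++
            [seq D1_Phi_idx a IJ | a <- iota 0 (qbracket q m),
                                   IJ <- calB_idx q m' n']
     else [:: [:: (n', 0)]]
   else [::])%N.

Lemma calB_idx_nvars q m n IJ : IJ \in calB_idx q m n ->
  (0 < size IJ)%N /\ (size IJ + sumn (unzip1 IJ))%N = n.
Proof.
elim: n m IJ => [|n IHn] [|m] IJ //=.
  by rewrite inE => /eqP -> /=; rewrite addn0 add1n.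
case: n IHn => [_|n IHn]; first by rewrite inE => /orP[/eqP ->|/mapP[a _ ->]].
rewrite mem_cat => /orP[/mapP[K /IHn[K0 KE] ->]|].
  by case: K K0 KE => [|[i j] K] //= _ <-; rewrite addSn addnS.
case/allpairsP => -[a K] /= [_ /IHn[_ KE] ->].
by rewrite /= add0n addSn KE.
Qed.

Definition calB (F : finFieldType) (m n : nat) : seq {mpoly F[n]} :=
  [seq polyof (Y F m IJ n) | IJ <- calB_idx #|F| m n].

(* Main.v *)
Require Import Defs.
From HB Require Import structures.
From mathcomp Require Import all_boot all_algebra all_field.
From mathcomp Require Import generic_quotient ring_quotient fraction.
From mathcomp Require Import zify ring.
From mathcomp.classical Require Import boolp.
From mathcomp.multinomials Require Import mpoly.

(** The proof goes by induction on the number of variables, numbered from 0 as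
    x_0, ..., x_{n-1}. Write q for the order of F.

    Consider the expansion of a Borel invariant f of Q_m(n) in powers of x_0. Because
    of the torus only the exponents k (q - 1) with k <= [m]_q occur (slice_torus). Let k
    be minimal and let g be the coefficient, an invariant of Q_m(n-1). If k < [m]_q,
    then the invariance under x_j := x_j + x_0 forces the Hasse derivatives of g of
    order 1, ..., q - 1 with respect to each variable to be 0 (slice_shift_var), so
    that g = y ^ q for an invariant y of Q_{m-1}(n-1), the Frobenius map from
    Q_{m-1}(n-1) to Q_m(n-1) being F-linear and injective (lowest_slice_frobq). If
    k = [m]_q, then f is the product of x_0 ^ (q ^ m - 1) with g, which is
    delta_{1;m}(g). In the other direction, Phi(Y) is an invariant of Q_m(n) whose value
    at x_0 = 0 is Y ^ q, so the product of the k-th power of D_1 with Phi(Y) has the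
    lowest coefficient Y ^ q. Hence B_m(n) is a basis as soon as B_m(n-1) and
    B_{m-1}(n-1) are (basis_ext, basis_step).

    There remain three facts about the Y_b(I; J): they are polynomials, they are
    invariant modulo the powers x_i ^ (q ^ b), and Phi lifts the Frobenius map. Here
    delta_{d+1;b}(f) is a quotient N / L, where L is the Moore determinant of
    x_0, ..., x_d, a product of pairwise coprime linear forms (L_prod, L_mdvd).

    Polynomiality: L divides N if and only if N vanishes on the hyperplanes of these
    forms. This becomes a linear condition on f (hyp_cond). For d + 1 it implies the
    condition for d, it is not affected by a factor D_{d+1} of f (hyp_cond_dickson),
    and it holds for all values of delta_{d+1;b}, since delta_{d+2;b} after
    delta_{d+1;b} is 0 by a Koszul relation (delta_num_delta_eq0, hyp_cond_delta). So it
    propagates through the nested expression that defines Y_b(I; J).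

    Invariance: the operators preserve exact invariance under the torus, and they
    preserve the property that for l < k the substitution x_k := x_k + t x_l changes f
    by a multiple of x_l ^ (q ^ b). Indeed N then changes by a multiple of
    x_l ^ (q ^ b + 1) if x_l occurs in L, and x_l divides L only once
    (delta_num_transv, transv_inv_delta). These substitutions and the torus suffice
    (borel_invariants_pi).

    The Frobenius map: the numerator and the denominator of delta_{d+2;b+1} are
    divisible by x_0; after division and at x_0 = 0, they are the q-th powers of those
    of delta_{d+1;b} (L_factor, frob_lift_delta). *)
Set Implicit Arguments.
Unset Strict Implicit.
Unset Printing Implicit Defensive.

Import GRing.Theory.

Local Open Scope ring_scope.
Local Open Scope quotient_scope.

(** * Polynomials evaluated at points *)
(** A point is an infinite sequence, so that omitting or changing one of its
    coordinates does not change its type; f sees only the first c coordinates. *)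
HB.lock Definition ev (F : finFieldType) c n (f : {mpoly F[c]})
    (v : nat -> {mpoly F[n]}) : {mpoly F[n]} :=
  f \mPo [tuple v i | i < c].

Section Points.
Variable F : finFieldType.
Local Notation q := #|F|.

(** The generic point of affine n-space, continued by 0. *)
Definition genpt n (i : nat) : {mpoly F[n]} :=
  if insub i is Some o then 'X_o else 0.

Definition upd n (v : nat -> {mpoly F[n]}) k a := fun i => if i == k then a else v i.

Definition omitpt n j (v : nat -> {mpoly F[n]}) := fun i => v (bump j i).

Lemma genpt_ord n (i : 'I_n) : genpt n i = 'X_i.
Proof. by rewrite /genpt valK. Qed.

Section EvalMorphism.
Variables (c n : nat) (v : nat -> {mpoly F[n]}).
Lemma evE (f : {mpoly F[c]}) : ev f v = f \mPo [tuple v i | i < c].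
Proof. by rewrite ev.unlock. Qed.
Lemma evD (f g : {mpoly F[c]}) : ev (f + g) v = ev f v + ev g v.
Proof. by rewrite !evE comp_mpolyD. Qed.
Lemma evB (f g : {mpoly F[c]}) : ev (f - g) v = ev f v - ev g v.
Proof. by rewrite !evE comp_mpolyB. Qed.
Lemma ev0 : ev (0 : {mpoly F[c]}) v = 0.
Proof. by rewrite evE comp_mpoly0. Qed.
Lemma ev1 : ev (1 : {mpoly F[c]}) v = 1.
Proof. by rewrite evE comp_mpoly1. Qed.
Lemma evM (f g : {mpoly F[c]}) : ev (f * g) v = ev f v * ev g v.
Proof. by rewrite !evE rmorphM. Qed.
Lemma evX (f : {mpoly F[c]}) e : ev (f ^+ e) v = ev f v ^+ e.
Proof. by rewrite !evE rmorphXn. Qed.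
Lemma evZ a (f : {mpoly F[c]}) : ev (a *: f) v = a *: ev f v.
Proof. by rewrite !evE comp_mpolyZ. Qed.
Lemma ev_sum I (r : seq I) (P : pred I) (f : I -> {mpoly F[c]}) :
  ev (\sum_(i <- r | P i) f i) v = \sum_(i <- r | P i) ev (f i) v.
Proof. by rewrite evE raddf_sum; apply: eq_bigr => i _; rewrite evE. Qed.
Lemma ev_prod I (r : seq I) (P : pred I) (f : I -> {mpoly F[c]}) :
  ev (\prod_(i <- r | P i) f i) v = \prod_(i <- r | P i) ev (f i) v.
Proof. by rewrite evE rmorph_prod; apply: eq_bigr => i _; rewrite evE. Qed.
Lemma ev_det d (A : 'M[{mpoly F[c]}]_d) :
  ev (\det A) v = \det (\matrix_(i, j) ev (A i j) v).
Proof.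
rewrite evE -det_map_mx; congr (\det _); apply/matrixP => i j.
by rewrite !mxE evE.
Qed.
Lemma evU (i : 'I_c) : ev 'X_i v = v i.
Proof. by rewrite evE comp_mpolyXU -tnth_nth tnth_mktuple. Qed.
Lemma ev_genpt i : (i < c)%N -> ev (genpt c i) v = v i.
Proof. by move=> ic; rewrite -[i]/(nat_of_ord (Ordinal ic)) genpt_ord evU. Qed.
End EvalMorphism.

(** Identities between substitutions are proved by comparing them on the variables. *)
Lemma mpoly_hom_eq c (S : nzRingType) (f g : {rmorphism {mpoly F[c]} -> S}) :
  (forall a, f a%:MP = g a%:MP) -> (forall i, f 'X_i = g 'X_i) -> f =1 g.
Proof.
move=> fgC fgX p; rewrite (mpolyE p) !rmorph_sum; apply: eq_bigr => m _ /=.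
rewrite -mul_mpolyC !rmorphM /= fgC; congr (_ * _).
rewrite mpolyXE_id !rmorph_prod; apply: eq_bigr => i _ /=.
by rewrite !rmorphXn /= fgX.
Qed.

Lemma eq_ev c n (f : {mpoly F[c]}) (v w : nat -> {mpoly F[n]}) :
  (forall i, (i < c)%N -> v i = w i) -> ev f v = ev f w.
Proof.
by move=> vw; rewrite !evE; congr (f \mPo _); apply: eq_mktuple => i; apply: vw.
Qed.

Lemma ev_id c (f : {mpoly F[c]}) : ev f (genpt c) = f.
Proof.
rewrite evE -[RHS]comp_mpoly_id; congr (_ \mPo _); apply: eq_mktuple => i.
exact: genpt_ord.
Qed.

Lemma ev_comp c n k (f : {mpoly F[c]}) (v : nat -> {mpoly F[n]})
    (w : nat -> {mpoly F[k]}) :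
  ev (ev f v) w = ev f (fun i => ev (v i) w).
Proof.
pose V := [tuple v i | i < c]; pose W := [tuple w i | i < n].
pose U := [tuple ev (v i) w | i < c].
rewrite !evE; apply: (mpoly_hom_eq (f := comp_mpoly W \o comp_mpoly V) (g := comp_mpoly U)).
  by move=> a /=; rewrite !comp_mpolyC.
by move=> i /=; rewrite !comp_mpolyXU -!tnth_nth !tnth_mktuple evE.
Qed.

Definition mdvd n (x y : {mpoly F[n]}) := exists u, y = x * u.

Lemma mdvd0 n (x : {mpoly F[n]}) : mdvd x 0.
Proof. by exists 0; rewrite mulr0. Qed.
Lemma mdvdxx n (x : {mpoly F[n]}) : mdvd x x.
Proof. by exists 1; rewrite mulr1. Qed.
Lemma mdvdD n (x y z : {mpoly F[n]}) : mdvd x y -> mdvd x z -> mdvd x (y + z).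
Proof. by move=> [u ->] [w ->]; exists (u + w); rewrite mulrDr. Qed.
Lemma mdvdMl n (x y z : {mpoly F[n]}) : mdvd x y -> mdvd x (z * y).
Proof. by move=> [u ->]; exists (z * u); rewrite mulrCA. Qed.
Lemma mdvdMr n (x y z : {mpoly F[n]}) : mdvd x y -> mdvd x (y * z).
Proof. by rewrite mulrC; apply: mdvdMl. Qed.
Lemma mdvdM n (x y z t : {mpoly F[n]}) : mdvd x y -> mdvd z t -> mdvd (x * z) (y * t).
Proof. by move=> [u ->] [w ->]; exists (u * w); rewrite mulrACA. Qed.
Lemma mdvd_sum n (x : {mpoly F[n]}) I (r : seq I) (P : pred I) f :
  (forall i, P i -> mdvd x (f i)) -> mdvd x (\sum_(i <- r | P i) f i).
Proof.
move=> h; elim/big_rec: _ => [|i y Pi]; first exact: mdvd0.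
by apply: mdvdD; apply: h.
Qed.
Lemma mdvd_ev c n (x y : {mpoly F[c]}) (v : nat -> {mpoly F[n]}) :
  mdvd x y -> mdvd (ev x v) (ev y v).
Proof. by move=> [u ->]; exists (ev u v); rewrite evM. Qed.

Lemma ev_cong c n (f : {mpoly F[c]}) (v w : nat -> {mpoly F[n]}) x :
  (forall i, (i < c)%N -> mdvd x (v i - w i)) -> mdvd x (ev f v - ev f w).
Proof.
move=> vw; elim/mpolyind: f => [|a m p _ _ IH].
  by rewrite !ev0 subrr; apply: mdvd0.
rewrite !evD opprD addrACA; apply: mdvdD => //.
rewrite !evZ -scalerBr -mul_mpolyC; apply: mdvdMl.
rewrite mpolyXE_id !ev_prod.
apply: (big_rec2 (fun y z => mdvd x (y - z))) => [|i y z _ IHi].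
  by rewrite subrr; apply: mdvd0.
have -> a1 a2 : a1 * y - a2 * z = (a1 - a2) * y + a2 * (y - z).
  by rewrite mulrBl mulrBr addrA subrK.
apply: mdvdD; last exact: mdvdMl.
rewrite !evX !evU subrXX.
by apply/mdvdMr/mdvdMr/vw.
Qed.

Lemma ev_upd c n (f : {mpoly F[c]}) (v : nat -> {mpoly F[n]}) k a :
  mdvd (a - v k) (ev f (upd v k a) - ev f v).
Proof.
apply: ev_cong => i _; rewrite /upd; case: eqP => [->|_]; first exact: mdvdxx.
by rewrite subrr; apply: mdvd0.
Qed.

Lemma upd_eq n (v : nat -> {mpoly F[n]}) k a : upd v k a k = a.
Proof. by rewrite /upd eqxx. Qed.

Lemma omitpt_upd_same n j (v : nat -> {mpoly F[n]}) a : omitpt j (upd v j a) =1 omitpt j v.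
Proof. by move=> i; rewrite /omitpt /upd eq_sym (negPf (neq_bump j i)). Qed.

Lemma omitpt_upd n j k (v : nat -> {mpoly F[n]}) a : k != j ->
  omitpt j (upd v k a) =1 upd (omitpt j v) (unbump j k) a.
Proof.
move=> kj i; rewrite /omitpt /upd; congr (if _ then _ else _).
by apply/eqP/eqP => [<-|->]; rewrite ?bumpK // unbumpKcond (negPf kj).
Qed.

Lemma omitpt_unbump n j k (v : nat -> {mpoly F[n]}) : k != j -> omitpt j v (unbump j k) = v k.
Proof. by move=> kj; rewrite /omitpt unbumpKcond (negPf kj). Qed.

(** Powers with exponent a power of q are additive, hence F-linear, in every
    commutative ring that receives F. *)
Lemma frobD_gen (S : comNzRingType) (h : {rmorphism F -> S}) (x y : S) e :
  (x + y) ^+ (q ^ e) = x ^+ (q ^ e) + y ^+ (q ^ e).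
Proof.
have [r r_pr charF] := finPcharP F.
have rS : r \in [pchar S] by apply: (rmorph_pchar h).
apply: exprDn_pchar.
by rewrite pnatX (eq_pnat _ (pcharf_eq rS)) (card_pprimeChar charF) pnatX pnat_id.
Qed.

Lemma frobD n (x y : {mpoly F[n]}) e :
  (x + y) ^+ (q ^ e) = x ^+ (q ^ e) + y ^+ (q ^ e).
Proof. exact: (frobD_gen (@mpolyC n F)). Qed.

Lemma qgt1 : (1 < q)%N. Proof. exact: finNzRing_gt1. Qed.
Lemma qgt0 : (0 < q)%N. Proof. exact: ltnW qgt1. Qed.
Lemma qe_gt0 e : (0 < q ^ e)%N. Proof. by rewrite expn_gt0 qgt0. Qed.

Lemma frobF (a : F) e : a ^+ (q ^ e) = a.
Proof. by elim: e => [|e IH]; rewrite ?expr1 // expnS exprM expf_card. Qed.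

Lemma frobZ n a (x : {mpoly F[n]}) e : (a *: x) ^+ (q ^ e) = a *: x ^+ (q ^ e).
Proof. by rewrite exprZn frobF. Qed.

Lemma frob0 n e : (0 : {mpoly F[n]}) ^+ (q ^ e) = 0.
Proof. by rewrite expr0n eqn0Ngt qe_gt0. Qed.

Lemma frob_sum n I (r : seq I) (P : pred I) (f : I -> {mpoly F[n]}) e :
  (\sum_(i <- r | P i) f i) ^+ (q ^ e) = \sum_(i <- r | P i) f i ^+ (q ^ e).
Proof.
by apply: (big_morph (fun x => x ^+ (q ^ e))); [move=> x y; apply: frobD | apply: frob0].
Qed.

Lemma frobB n (x y : {mpoly F[n]}) e :
  (x - y) ^+ (q ^ e) = x ^+ (q ^ e) - y ^+ (q ^ e).
Proof. by rewrite frobD -!scaleN1r frobZ. Qed.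

Lemma frobq_sum n I (r : seq I) (P : pred I) (f : I -> {mpoly F[n]}) :
  (\sum_(i <- r | P i) f i) ^+ q = \sum_(i <- r | P i) f i ^+ q.
Proof. by have := frob_sum r P f 1; rewrite expn1. Qed.

Lemma frobq_linear n (p r : {mpoly F[n]}) a : (a *: p + r) ^+ q = a *: p ^+ q + r ^+ q.
Proof.
by have := frobD (a *: p) r 1; rewrite expn1 exprZn expf_card.
Qed.

End Points.

(** * Moore determinants *)
Section Moore.
Variable F : finFieldType.
Local Notation q := #|F|.
Variable n : nat.
Implicit Types (v w : nat -> {mpoly F[n]}) (a : nat -> F) (e : nat -> nat).

(** For e the identity this is the determinant L_d. The exponents e = bump d, that
    is 0, ..., d - 1, d + 1, give the numerator of the Dickson invariant D_{d+1}. *)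
Definition moore_det e d v : {mpoly F[n]} := \det (\matrix_(j < d, i < d) v j ^+ (q ^ e i)).
(** Numerators of the operators delta have this shape. *)
Definition bordered_det e d w v : {mpoly F[n]} :=
  \det (\matrix_(j < d.+1, i < d.+1) if (i < d)%N then v j ^+ (q ^ e i) else w j).

Lemma eq_moore_det e d v v' : (forall i, (i < d)%N -> v i = v' i) ->
  moore_det e d v = moore_det e d v'.
Proof. by move=> vv'; congr (\det _); apply/matrixP => j i; rewrite !mxE vv'. Qed.

Lemma moore_det_bordered e d v :
  moore_det e d.+1 v = bordered_det e d (fun j => v j ^+ (q ^ e d)) v.
Proof.
congr (\det _); apply/matrixP => j i; rewrite !mxE; case: ltnP => // di.
by have -> : i = d :> nat by apply/eqP; rewrite eqn_leq di -ltnS ltn_ord.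
Qed.

Lemma bordered_det_expand e d w v :
  bordered_det e d w v = \sum_(j < d.+1) (-1) ^+ (d + j) * w j * moore_det e d (omitpt j v).
Proof.
rewrite /bordered_det (expand_det_col _ ord_max); apply: eq_bigr => j _.
rewrite !mxE /= ltnn /cofactor mulrCA mulrA addnC; congr (_ * _).
congr (\det _); apply/matrixP => k i; rewrite !mxE lift_max ltn_ord.
by [].
Qed.

(** Raising to a power of q is F-linear, so an F-linear relation between the
    coordinates of v that w satisfies too is a relation between all the rows. *)
Lemma bordered_det_eq0 e d w v a k : (k <= d)%N -> a k != 0 ->
  \sum_(j < d.+1) a j *: v j = 0 -> \sum_(j < d.+1) a j *: w j = 0 ->
  bordered_det e d w v = 0.
Proof.
move=> kd ak av aw; rewrite /bordered_det; set A := \matrix_(_, _) _.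
pose r : 'rV[{mpoly F[n]}]_d.+1 := \row_j (a j)%:MP.
have rA : r *m A = 0.
  apply/rowP => i; rewrite !mxE; case: (ltnP i d) => id_.
    transitivity ((\sum_(j < d.+1) a j *: v j) ^+ (q ^ e i)).
      by rewrite frob_sum; apply: eq_bigr => j _; rewrite !mxE id_ mul_mpolyC frobZ.
    by rewrite av frob0.
  rewrite -[RHS]aw; apply: eq_bigr => j _.
  by rewrite !mxE ltnNge id_ /= mul_mpolyC.
have := congr1 (mulmx^~ (\adj A)) rA.
rewrite -mulmxA mul_mx_adj mul_mx_scalar mul0mx => /rowP/(_ (Ordinal (kd : k < d.+1)%N)).
by rewrite !mxE mulrC mul_mpolyC => /eqP; rewrite scaler_eq0 (negPf ak) => /eqP.
Qed.

(** The maximal minors of a d by d + 1 matrix are proportional to the coefficients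
    of a relation between its d + 1 rows. They are compared by bordering the matrix
    with a vector w supported at j and k which satisfies the same relation. *)
Lemma moore_det_minor e d v a k j : (k <= d)%N -> (j <= d)%N -> a k != 0 ->
  \sum_(i < d.+1) a i *: v i = 0 ->
  a k *: ((-1) ^+ j * moore_det e d (omitpt j v)) =
  a j *: ((-1) ^+ k * moore_det e d (omitpt k v)).
Proof.
move=> kd jd ak av; apply/eqP; rewrite -subr_eq0.
pose w i : {mpoly F[n]} := (a k *+ (i == j) - a j *+ (i == k))%:MP.
have := @bordered_det_eq0 e d w v a k kd ak av; rewrite bordered_det_expand.
have sumD (f : nat -> {mpoly F[n]}) m : (m <= d)%N ->
    \sum_(i < d.+1) (f i) *+ (i == m :> nat) = f m.
  move=> md; rewrite (bigD1 (Ordinal (md : m < d.+1)%N)) //= eqxx big1 ?addr0 // => i.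
  by rewrite -val_eqE /= => /negPf ->.
have wE i x : w i * x = (a k *: x) *+ (i == j) - (a j *: x) *+ (i == k).
  by rewrite /w mpolyCB !mpolyCMn mulrBl !mulrnAl !mul_mpolyC.
rewrite (eq_bigr (fun i : 'I_d.+1 =>
    ((a k * a i)%:MP *+ (i == j :> nat)) - ((a j * a i)%:MP *+ (i == k :> nat)))); last first.
  move=> i _; rewrite -mul_mpolyC mulrC wE.
  by rewrite -!mul_mpolyC -!mpolyCM.
rewrite sumrB (sumD (fun i => (a k * a i)%:MP)) // (sumD (fun i => (a j * a i)%:MP)) //.
rewrite [a j * _]mulrC subrr => /(_ erefl).
rewrite (eq_bigr (fun i : 'I_d.+1 =>
    (a k *: ((-1) ^+ (d + i) * moore_det e d (omitpt i v))) *+ (i == j :> nat) -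
    (a j *: ((-1) ^+ (d + i) * moore_det e d (omitpt i v))) *+ (i == k :> nat))); last first.
  by move=> i _; rewrite -mulrA mulrCA wE.
rewrite sumrB (sumD (fun i => a k *: ((-1) ^+ (d + i) * moore_det e d (omitpt i v)))) //.
rewrite (sumD (fun i => a j *: ((-1) ^+ (d + i) * moore_det e d (omitpt i v)))) //.
rewrite !exprD -!mulrA !scalerAr -mulrBr => /eqP.
by rewrite mulrI_eq0 //; apply/lreg_sign.
Qed.

Lemma moore_det_upd e d v k (x y : {mpoly F[n]}) (s t : F) : (k < d)%N ->
  moore_det e d (upd v k (s *: x + t *: y)) =
  s *: moore_det e d (upd v k x) + t *: moore_det e d (upd v k y).
Proof.
move=> kd; rewrite -!mul_mpolyC.
apply: (determinant_multilinear (i0 := Ordinal kd)).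
- by apply/rowP => i; rewrite !mxE /upd /= eqxx frobD !mul_mpolyC !frobZ.
- by apply/matrixP => j i; rewrite !mxE /upd /= eq_sym (negPf (neq_bump _ _)).
- by apply/matrixP => j i; rewrite !mxE /upd /= eq_sym (negPf (neq_bump _ _)).
Qed.

Lemma upd_id v k : upd v k (v k) =1 v.
Proof. by move=> i; rewrite /upd; case: eqP => [->|]. Qed.

Lemma moore_det_updZ e d v k s : (k < d)%N ->
  moore_det e d (upd v k (s *: v k)) = s *: moore_det e d v.
Proof.
move=> kd; have := moore_det_upd e v (v k) 0 s 0 kd.
rewrite scaler0 addr0 scale0r addr0 => ->; congr (_ *: _).
by apply: eq_moore_det => i _; apply: upd_id.
Qed.

Lemma moore_det_updD e d v k l t : (k < d)%N -> (l < d)%N -> l != k ->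
  moore_det e d (upd v k (v k + t *: v l)) = moore_det e d v.
Proof.
move=> kd ld lk; rewrite -[v k]scale1r moore_det_upd // scale1r.
rewrite [X in _ + t *: X](_ : _ = 0) ?scaler0 ?addr0.
  by apply: eq_moore_det => i _; apply: upd_id.
apply: (@determinant_alternate _ _ _ (Ordinal kd) (Ordinal ld)).
  by rewrite -val_eqE eq_sym.
by move=> i; rewrite !mxE /upd /= eqxx (negPf lk).
Qed.

Lemma moore_det_upd_ge e d v k x : (d <= k)%N -> moore_det e d (upd v k x) = moore_det e d v.
Proof.
move=> dk; apply: eq_moore_det => i id_; rewrite /upd ifN //.
by apply: contraTneq id_ => ->; rewrite -leqNgt.
Qed.

Local Notation L := (moore_det id).

Lemma det_frob d (A : 'M[{mpoly F[n]}]_d) :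
  \det (\matrix_(i, j) A i j ^+ q) = (\det A) ^+ q.
Proof.
rewrite /determinant -[q]expn1 frob_sum; apply: eq_bigr => s _.
rewrite exprMn -prodrXl; congr (_ * _); last by apply: eq_bigr => i _; rewrite mxE.
by rewrite -exprM mulnC exprM -scaleN1r frobZ expr1n.
Qed.

(** In the row of v_l only the entry v_l itself is not divisible by v_l ^ 2, and
    its cofactor is the q-th power of a smaller Moore determinant. Hence a variable
    that occurs in L divides it exactly once, and the quotient is known on the
    hyperplane where the variable is 0. *)
Lemma L_factor d v l : (l <= d)%N ->
  exists u, L d.+1 v = v l * ((-1) ^+ l * L d (omitpt l v) ^+ q + v l * u).
Proof.
move=> ld; pose l' := Ordinal (ld : l < d.+1)%N.
rewrite /moore_det (expand_det_row _ l') big_ord_recl !mxE /= expr1.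
set S := \sum_(_ < _) _.
have [u Su] : mdvd (v l * v l) S.
  apply: mdvd_sum => i _; rewrite !mxE; apply: mdvdMr.
  rewrite lift0 -expr2 -(subnK (_ : 2 <= q ^ i.+1)%N) ?exprD; last first.
    by rewrite (leq_trans (qgt1 F)) // expnS leq_pmulr ?qe_gt0.
  exact/mdvdMl/mdvdxx.
exists u; rewrite Su mulrDr !mulrA; congr (_ + _); rewrite -!mulrA; congr (_ * _).
rewrite /cofactor addn0; congr (_ * _).
rewrite -det_frob; congr (\det _); apply/matrixP => j i.
by rewrite !mxE lift0 /omitpt expnS mulnC exprM.
Qed.

End Moore.
Notation L := (moore_det id).

(** * The linear factors of a Moore determinant *)
Section Factor.
Variable F : finFieldType.
Local Notation q := #|F|.
Variable n : nat.
Implicit Types (v w : nat -> {mpoly F[n]}) (a : nat -> F).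
Local Notation "p %:F" := (FracField.tofrac p).

Definition indep d v :=
  forall a, \sum_(i < d) a i *: v i = 0 -> forall i, (i < d)%N -> a i = 0.

Lemma indepS d v : indep d.+1 v -> indep d v.
Proof.
move=> vi a av i id_; pose b j := if (j < d)%N then a j else 0.
have := vi b; rewrite big_ord_recr /= {2}/b ltnn scale0r addr0.
rewrite (eq_bigr (fun i : 'I_d => a i *: v i)); last first.
  by move=> j _; rewrite /b ltn_ord.
by move=> /(_ av i (ltnW id_)); rewrite /b id_.
Qed.

(** The coefficients of the linear form c_0 x_0 + ... + c_{k-1} x_{k-1} - x_k. *)
Definition form_coef k (c : {ffun 'I_k -> F}) (i : nat) : F :=
  if insub i is Some o then c o else if i == k then -1 else 0.

Lemma form_coef_lt k (c : {ffun 'I_k -> F}) (i : 'I_k) : form_coef c i = c i.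
Proof. by rewrite /form_coef valK. Qed.
Lemma form_coef_eq k (c : {ffun 'I_k -> F}) : form_coef c k = -1.
Proof. by rewrite /form_coef insubF ?ltnn // eqxx. Qed.
Lemma form_coef_gt k (c : {ffun 'I_k -> F}) i : (k < i)%N -> form_coef c i = 0.
Proof. by move=> ki; rewrite /form_coef insubF ?gtn_eqF // ltnNge ltnW. Qed.

Lemma L_root d v a :
  L d.+1 (upd v d (\sum_(i < d) a i *: v i)) = 0.
Proof.
rewrite moore_det_bordered; pose b i : F := if (i < d)%N then a i else -1.
have bE w : (forall i, (i < d)%N -> w i = v i) -> w d = \sum_(i < d) a i *: v i ->
    \sum_(j < d.+1) b j *: w j = 0.
  move=> wv wd; rewrite big_ord_recr /= {2}/b ltnn scaleN1r wd.
  apply/eqP; rewrite subr_eq0; apply/eqP/eq_bigr => i _.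
  by rewrite /b ltn_ord wv.
have b0 : \sum_(j < d.+1) b j *: upd v d (\sum_(i < d) a i *: v i) j = 0.
  by apply: bE => [i id_|]; rewrite /upd ?eqxx // ltn_eqF.
apply: (@bordered_det_eq0 _ _ _ _ _ _ b d) => //.
  by rewrite /b ltnn oppr_eq0 oner_eq0.
transitivity ((\sum_(j < d.+1) b j *: upd v d (\sum_(i < d) a i *: v i) j) ^+ (q ^ d)).
  by rewrite frob_sum; apply: eq_bigr => j _; rewrite frobZ.
by rewrite b0 frob0.
Qed.

(** As a polynomial in its last coordinate, L_{d+1} has degree q ^ d and leading
    coefficient L_d, and it vanishes at the q ^ d combinations of the others. *)
Lemma L_prod d v : indep d v -> L d v != 0 ->
  L d.+1 v = L d v * \prod_(c : {ffun 'I_d -> F}) (v d - \sum_(i < d) c i *: v i).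
Proof.
move=> vi L0.
pose cf (i : nat) : {mpoly F[n]} :=
  cofactor (\matrix_(j < d.+1, i < d.+1) v j ^+ (q ^ i)) ord_max (inord i).
have LE y : L d.+1 (upd v d y) = \sum_(i < d.+1) y ^+ (q ^ i) * cf i.
  rewrite /moore_det (expand_det_row _ ord_max); apply: eq_bigr => i _.
  rewrite !mxE /upd /= eqxx /cf inord_val /cofactor; congr (_ * (_ * _)).
  congr (\det _); apply/matrixP => j k; rewrite !mxE.
  by rewrite lift_max ltn_eqF.
have cfd : cf d = L d v.
  rewrite /cf (_ : inord d = ord_max); last by apply: val_inj; rewrite /= inordK.
  rewrite /cofactor addnn -signr_odd odd_double mul1r; congr (\det _).
  by apply/matrixP => j k; rewrite !mxE !lift_max.
(* P is L_{d+1} as a polynomial in the last coordinate; the roots are counted over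
   a field. *)
pose P : {poly {fraction {mpoly F[n]}}} := \sum_(i < d.+1) (cf i)%:F *: 'X^(q ^ i).
have PE y : P.[y%:F] = (L d.+1 (upd v d y))%:F.
  rewrite LE horner_sum rmorph_sum; apply: eq_bigr => i _ /=.
  by rewrite hornerZ hornerXn [RHS]tofracM mulrC tofracXn.
pose Q : {poly {fraction {mpoly F[n]}}} := \sum_(i < d) (cf i)%:F *: 'X^(q ^ i).
have szlow : (size Q <= q ^ d)%N.
  apply: (leq_trans (size_sum _ _ _)); apply/bigmax_leqP => i _.
  apply: (leq_trans (size_scale_leq _ _)); rewrite size_polyXn.
  by rewrite ltn_exp2l ?qgt1.
have Pd : P = Q + (L d v)%:F *: 'X^(q ^ d).
  by rewrite /P big_ord_recr /= cfd.
have LF0 : (L d v)%:F != 0 by rewrite tofrac_eq0.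
have szP : size P = (q ^ d).+1.
  by rewrite Pd addrC size_polyDl size_scale ?size_polyXn.
have leadP : lead_coef P = (L d v)%:F.
  by rewrite Pd addrC lead_coefDl ?size_scale ?size_polyXn // lead_coefZ lead_coefXn mulr1.
pose y (c : {ffun 'I_d -> F}) := \sum_(i < d) c i *: v i.
pose rs := [seq (y c)%:F | c <- enum {ffun 'I_d -> F}].
have yE c : y c = \sum_(i < d) form_coef c i *: v i.
  by apply: eq_bigr => i _; rewrite form_coef_lt.
have urs : uniq rs.
  rewrite map_inj_uniq ?enum_uniq // => c c' /eqP; rewrite tofrac_eq => /eqP ycc.
  apply/ffunP => i; apply/eqP; rewrite -subr_eq0 -!form_coef_lt; apply/eqP.
  apply: (vi (fun i => form_coef c i - form_coef c' i)) (ltn_ord i).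
  rewrite (eq_bigr (fun i : 'I_d => form_coef c i *: v i - form_coef c' i *: v i)); last first.
    by move=> j _; rewrite scalerBl.
  by rewrite sumrB -!yE ycc subrr.
have := @all_roots_prod_XsubC _ P rs.
rewrite szP size_map -cardE card_ffun card_ord => /(_ erefl).
have -> : all (root P) rs.
  apply/allP => z /mapP[c _ ->]; rewrite /root PE yE L_root.
  by rewrite rmorph0.
rewrite uniq_rootsE urs => /(_ isT isT) PP.
apply/eqP; rewrite -tofrac_eq; apply/eqP.
have -> : L d.+1 v = L d.+1 (upd v d (v d)) by apply: eq_moore_det => i _; rewrite upd_id.
rewrite -PE PP leadP hornerZ rmorphM rmorph_prod; congr (_ * _).
rewrite horner_prod big_map enumT; apply: eq_bigr => c _ /=.
by rewrite hornerXsubC rmorphB.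
Qed.

Lemma L_neq0 d v : indep d v -> L d v != 0.
Proof.
elim: d => [|d IH] vi; first by rewrite /moore_det det_mx00 oner_eq0.
have vi' := indepS vi; have L0 := IH vi'.
rewrite L_prod // mulf_neq0 //; apply/prodf_neq0 => c _.
apply/eqP => c0; have := vi (form_coef c); rewrite big_ord_recr /=.
rewrite form_coef_eq scaleN1r (eq_bigr (fun i : 'I_d => c i *: v i)); last first.
  by move=> i _; rewrite form_coef_lt.
rewrite -opprB c0 oppr0 => /(_ erefl d (ltnSn d)) /eqP.
by rewrite form_coef_eq oppr_eq0 oner_eq0.
Qed.

Lemma mcoeff_genpt i (j : 'I_n) : (genpt F n i)@_U_(j) = (i == j)%:R.
Proof.
rewrite /genpt; case: insubP => [o _ <-|]; last first.
  by case: eqP => [->|_]; rewrite ?ltn_ord ?mcoeff0.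
by rewrite mcoeffX eq_mnm1.
Qed.

Lemma indep_genpt d (s : nat -> nat) : (forall i, (i < d)%N -> (s i < n)%N) ->
  (forall i j, (i < d)%N -> (j < d)%N -> s i = s j -> i = j) ->
  indep d (fun i => genpt F n (s i)).
Proof.
move=> sn si a a0 i id_.
have := congr1 (mcoeff U_(Ordinal (sn i id_))) a0.
rewrite mcoeff0 raddf_sum /= (bigD1 (Ordinal id_)) //= big1 => [|j ji].
  by rewrite mcoeffZ mcoeff_genpt eqxx mulr1 addr0.
rewrite mcoeffZ mcoeff_genpt /=; case: eqP => [/si sij|_]; last by rewrite mulr0.
by case/eqP: ji; apply: val_inj; apply: sij.
Qed.

Lemma L_genpt_neq0 d : (d <= n)%N -> L d (genpt F n) != 0.
Proof.
move=> dn; apply: (@L_neq0 _ (fun i => genpt F n (id i))).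
by apply: indep_genpt => // i id_; apply: leq_trans dn.
Qed.

Lemma L_omitpt_neq0 d k : (d < n)%N -> L d (omitpt k (genpt F n)) != 0.
Proof.
move=> dn; apply: (@L_neq0 _ (fun i => genpt F n (bump k i))).
apply: indep_genpt => [i id_|i j _ _]; last exact: (can_inj (bumpK k)).
by rewrite /bump; case: (k <= i)%N; rewrite ?add1n ?add0n;
  [apply: leq_ltn_trans dn | apply: ltn_trans dn].
Qed.

(** The generic point of the hyperplane x_k = a_0 x_0 + ... + a_{k-1} x_{k-1}. *)
Definition hyppt k a := upd (genpt F n) k (\sum_(i < k) a i *: genpt F n i).

(** A form l_i is prime when the polynomials that vanish at the generic point of
    its hyperplane are its multiples. Since no other form of the list vanishes
    there, the forms can be divided out of N one after the other. *)
Lemma mdvd_prod_hyppt (I : eqType) (ls : seq I) (l : I -> {mpoly F[n]})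
    (h : I -> nat -> {mpoly F[n]}) (N : {mpoly F[n]}) :
  uniq ls ->
  (forall i (p : {mpoly F[n]}), i \in ls -> ev p (h i) = 0 -> mdvd (l i) p) ->
  (forall i j, i \in ls -> j \in ls -> i != j -> ev (l j) (h i) != 0) ->
  (forall i, i \in ls -> ev N (h i) = 0) -> mdvd (\prod_(i <- ls) l i) N.
Proof.
elim: ls => [|i ls IH] /=; first by rewrite big_nil => *; exists N; rewrite mul1r.
move=> /andP[ils uls] dvl neql N0; rewrite big_cons.
have [|||u Nu] := IH uls.
- by move=> j p jls; apply: dvl; rewrite inE jls orbT.
- by move=> j k jls kls; apply: neql; rewrite inE ?jls ?kls orbT.
- by move=> j jls; apply: N0; rewrite inE jls orbT.
have : ev N (h i) = 0 by apply: N0; rewrite mem_head.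
rewrite Nu evM => /eqP; rewrite mulf_eq0 => /orP[|/eqP u0]; last first.
  have [w ->] := dvl i u (mem_head _ _) u0.
  by exists w; rewrite mulrCA mulrA.
have : ev (\prod_(j <- ls) l j) (h i) != 0.
  rewrite ev_prod prodf_seq_neq0; apply/allP => j jls /=.
  apply: neql; rewrite ?inE ?eqxx ?jls ?orbT //.
  by apply: contraNneq ils => ->.
by move/negPf=> ->.
Qed.

(** Moving x_k to its value on the hyperplane changes p by a multiple of the form. *)
Lemma mdvd_form k a (p : {mpoly F[n]}) :
  ev p (hyppt k a) = 0 -> mdvd (genpt F n k - \sum_(i < k) a i *: genpt F n i) p.
Proof.
move=> p0; have [u] := ev_upd p (genpt F n) k (\sum_(i < k) a i *: genpt F n i).
rewrite -/(hyppt k a) p0 ev_id sub0r => /(canRL (@opprK _)) ->.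
by exists u; rewrite -mulNr opprB.
Qed.

(** Two different forms with the same last variable differ by a nonzero form in
    the earlier variables, on which the hyperplane imposes no relation. *)
Lemma ev_form_same_neq0 k k' a a' : (k < n)%N -> (k' < n)%N ->
  k = k' -> (exists2 i, (i < k)%N & a i != a' i) ->
  ev (genpt F n k' - \sum_(i < k') a' i *: genpt F n i) (hyppt k a) != 0.
Proof.
move=> kn _ <- [i ik ai]; pose i' := Ordinal (ltn_trans ik kn).
have mE (b : nat -> F) : (\sum_(j < k) b j *: genpt F n j)@_U_(i') = b i.
  rewrite raddf_sum (bigD1 (Ordinal ik)) //= mcoeffZ mcoeff_genpt eqxx mulr1 big1 ?addr0 //.
  move=> j; rewrite -val_eqE /= => /negPf ji.
  by rewrite mcoeffZ mcoeff_genpt /= ji mulr0.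
apply: contraNneq ai => /(congr1 (mcoeff U_(i'))).
rewrite evB ev_sum ev_genpt // /hyppt {1}/upd eqxx mcoeffB mcoeff0 mE.
under eq_bigr => j _.
  rewrite evZ ev_genpt /upd ?(ltn_eqF (ltn_ord j)); last exact: ltn_trans (ltn_ord j) kn.
  over.
by rewrite mE => /eqP; rewrite subr_eq0.
Qed.

(** If the last variables differ, the one of the form evaluated keeps coefficient 1
    on the hyperplane. *)
Lemma ev_form_diff_neq0 k k' a a' : (k < n)%N -> (k' < n)%N -> k != k' ->
  ev (genpt F n k' - \sum_(i < k') a' i *: genpt F n i) (hyppt k a) != 0.
Proof.
move=> kn k'n kk'; pose K := Ordinal k'n.
have hE i : (i <= k')%N -> (hyppt k a i)@_U_(K) = (i == k')%:R.
  move=> ik; rewrite /hyppt /upd; case: eqP => [ik0|_]; last by rewrite mcoeff_genpt.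
  rewrite ik0 (negPf kk') raddf_sum big1 //= => j _.
  rewrite mcoeffZ mcoeff_genpt ltn_eqF ?mulr0 //.
  by rewrite (leq_trans (ltn_ord j)) // -ik0.
apply/eqP => /(congr1 (mcoeff U_(K))); rewrite evB ev_sum ev_genpt // mcoeffB hE //.
rewrite eqxx mcoeff0 raddf_sum big1 ?subr0 => [/eqP|j _]; first by rewrite oner_eq0.
rewrite evZ ev_genpt ?(ltn_trans (ltn_ord j)) //= mcoeffZ hE ?ltn_eqF ?mulr0 //.
exact: ltnW.
Qed.

(** L is the product of the forms x_k - (a_0 x_0 + ... + a_{k-1} x_{k-1}), k < d, and
    any two of them are coprime. *)
Lemma L_mdvd d (N : {mpoly F[n]}) : (d <= n)%N ->
  (forall k a, (k < d)%N -> a k = -1 -> (forall j, (k < j)%N -> a j = 0) ->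
     ev N (hyppt k a) = 0) -> mdvd (L d (genpt F n)) N.
Proof.
move=> dn N0.
pose l k (c : {ffun 'I_k -> F}) := genpt F n k - \sum_(i < k) form_coef c i *: genpt F n i.
have -> : L d (genpt F n) = \prod_(k < d) \prod_(c : {ffun 'I_k -> F}) l k c.
  elim: d dn {N0} => [|d IH] dn; first by rewrite big_ord0 /moore_det det_mx00.
  rewrite big_ord_recr /= -IH ?(ltnW dn) // L_prod ?L_genpt_neq0 ?(ltnW dn) //.
    congr (_ * _); apply: eq_bigr => c _; congr (_ - _); apply: eq_bigr => i _.
    by rewrite form_coef_lt.
  apply: (@indep_genpt _ id) => // i id_; exact: ltn_trans dn.
rewrite sig_big_dep /=.
pose h (p : {k : 'I_d & {ffun 'I_k -> F}}) := hyppt (tag p) (form_coef (tagged p)).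
apply: (mdvd_prod_hyppt (h := h)) => [|[k c] p _|[k c] [k' c'] _ _|[k c] _].
- exact: index_enum_uniq.
- exact: mdvd_form.
- have kn (j : 'I_d) : (j < n)%N by apply: leq_trans dn.
  move=> ne; have [kk|kk] := eqVneq k k'; last exact: ev_form_diff_neq0.
  subst k'; apply: ev_form_same_neq0 => //=.
  have /existsP[i ci] : [exists i, c i != c' i].
    rewrite -negb_forall; apply: contra ne => /forallP cc.
    by apply/eqP; congr (Tagged _ _); apply/ffunP => i; apply/eqP.
  by exists i; rewrite ?form_coef_lt.
- by apply: N0; rewrite //= ?form_coef_eq // => j; apply: form_coef_gt.
Qed.

End Factor.

(** * The operators delta on polynomials *)
Lemma sum_lift (V : zmodType) m (j : 'I_m.+1) (f : 'I_m.+1 -> V) :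
  \sum_(i < m) f (lift j i) = \sum_(r < m.+1 | r != j) f r.
Proof.
rewrite [RHS](reindex_omap (lift j) (unlift j)); last first.
  by move=> i; case: unliftP => [k ->|->]; rewrite ?eqxx.
by apply: eq_bigl => i; rewrite liftK eq_sym eqxx neq_lift.
Qed.

(** The terms (i, j) and (j, i) are cancelled in pairs, which is valid in
    characteristic 2 as well. *)
Lemma sum_antisym (V : zmodType) m (G : nat -> nat -> V) :
  (forall i j, i != j -> G i j = - G j i) ->
  \sum_(j < m) \sum_(r < m | r != j) G j r = 0.
Proof.
move=> Gs.
have split_neq (j : 'I_m) : \sum_(r < m | r != j) G j r =
    \sum_(r < m | (r < j)%N) G j r + \sum_(r < m | (j < r)%N) G j r.
  rewrite (bigID (fun r : 'I_m => (r < j)%N)) /=; congr (_ + _); apply: eq_bigl => r.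
    by rewrite -val_eqE /=; case: ltngtP.
  by rewrite -val_eqE /=; case: ltngtP.
under eq_bigr do rewrite split_neq.
rewrite big_split /= [X in _ + X](exchange_big_dep predT) //= -big_split /=.
rewrite big1 // => j _; rewrite -big_split big1 //= => r rj.
by rewrite [G j r]Gs ?addNr // gtn_eqF.
Qed.

Section Operator.
Variable F : finFieldType.
Local Notation q := #|F|.

(** The numerator of delta_{d+1;b}(f). *)
Definition delta_num b d c (f : {mpoly F[c]}) n (v : nat -> {mpoly F[n]}) :=
  bordered_det id d (fun j => v j ^+ (q ^ b) * ev f (omitpt j v)) v.

Lemma delta_numE b d c (f : {mpoly F[c]}) n (v : nat -> {mpoly F[n]}) :
  delta_num b d f v =
  \sum_(j < d.+1) (-1) ^+ (d + j) * (v j ^+ (q ^ b) * ev f (omitpt j v)) * L d (omitpt j v).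
Proof. exact: bordered_det_expand. Qed.

(** This says that delta_{d+1;b}(f) is the polynomial z. *)
Definition is_delta b d c (f : {mpoly F[c]}) (z : {mpoly F[c.+1]}) :=
  L d.+1 (genpt F c.+1) * z = delta_num b d f (genpt F c.+1).

Lemma ev_moore_det e d n k (w : nat -> {mpoly F[n]}) (v : nat -> {mpoly F[k]}) :
  ev (moore_det e d w) v = moore_det e d (fun i => ev (w i) v).
Proof.
rewrite /moore_det ev_det; congr (\det _); apply/matrixP => j i.
by rewrite !mxE evX.
Qed.

Lemma ev_moore_det_genpt e d n k (v : nat -> {mpoly F[k]}) : (d <= n)%N ->
  ev (moore_det e d (genpt F n)) v = moore_det e d v.
Proof.
move=> dn; rewrite ev_moore_det; apply: eq_moore_det => i id_.
by rewrite ev_genpt ?(leq_trans id_).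
Qed.

Lemma ev_delta_num b d c (f : {mpoly F[c]}) k (v : nat -> {mpoly F[k]}) : (d <= c)%N ->
  ev (delta_num b d f (genpt F c.+1)) v = delta_num b d f v.
Proof.
move=> dc; rewrite /delta_num /bordered_det ev_det; congr (\det _); apply/matrixP => j i.
have jc : (j < c.+1)%N by apply: leq_trans (ltn_ord j) _.
rewrite !mxE; case: ifP => _; first by rewrite evX ev_genpt.
rewrite evM evX ev_genpt // ev_comp; congr (_ * _).
apply: eq_ev => l lc; rewrite ev_genpt // /bump.
by case: (j <= l)%N; rewrite ?add0n // ltnW.
Qed.

Lemma is_deltaE b d c (f : {mpoly F[c]}) z n (v : nat -> {mpoly F[n]}) :
  (d <= c)%N -> is_delta b d f z -> L d.+1 v * ev z v = delta_num b d f v.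
Proof.
by move=> dc zE; rewrite -(@ev_moore_det_genpt _ _ c.+1) // -evM zE ev_delta_num.
Qed.

(** The Koszul relation: delta_{d+2;b} after delta_{d+1;b} is zero. Expanding both
    numerators gives a sum over pairs of omitted coordinates, in which each pair
    occurs twice, with opposite signs. *)
Lemma delta_num_delta_eq0 b d c (f : {mpoly F[c]}) z n (v : nat -> {mpoly F[n]}) :
  (d <= c)%N -> is_delta b d f z -> delta_num b d.+1 z v = 0.
Proof.
move=> dc zE; rewrite delta_numE.
(* S p r is the term in which x_p and x_r are omitted, without its sign. *)
pose S p r := v p ^+ (q ^ b) * v r ^+ (q ^ b) *
   (ev f (omitpt (unbump p r) (omitpt p v)) * L d (omitpt (unbump p r) (omitpt p v))).
pose G p r := (-1) ^+ (p + unbump p r).+1 * S p r.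
have bmpC p r : p != r -> omitpt (unbump p r) (omitpt p v) =1 omitpt (unbump r p) (omitpt r v).
  move=> pr i; rewrite /omitpt bumpC unbumpKcond eq_sym (negPf pr) add0n.
  by congr (v (bump r (bump _ i))); rewrite /unbump; lia.
have SC p r : p != r -> S p r = S r p.
  move=> pr; rewrite /S (@eq_ev _ _ _ f _ (omitpt (unbump r p) (omitpt r v))); last first.
    by move=> i _; apply: bmpC.
  rewrite (@eq_moore_det _ _ _ _ _ (omitpt (unbump r p) (omitpt r v))); last first.
    by move=> i _; apply: bmpC.
  by rewrite (mulrC (v r ^+ (q ^ b))).
rewrite -[RHS](@sum_antisym _ d.+2 G); last first.
  move=> p r pr; rewrite /G SC // -mulNr -signr_odd -[in RHS]signr_odd; congr (_ * _).
  have -> : odd (p + unbump p r).+1 = ~~ odd (r + unbump r p).+1.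
    by rewrite /unbump; lia.
  by rewrite signrN.
apply: eq_bigr => j _; rewrite -mulrA -mulrA [ev _ _ * _]mulrC (is_deltaE _ dc zE).
rewrite -(sum_lift j (G j)) delta_numE !mulr_sumr; apply: eq_bigr => i _.
rewrite /G /S /= bumpK -/(omitpt j v).
have -> : (-1) ^+ (j + i).+1 = (-1) ^+ (d.+1 + j) * (-1) ^+ (d + i) :> {mpoly F[n]}.
  by rewrite -exprD -signr_odd -[RHS]signr_odd; congr (_ ^+ (nat_of_bool _)); lia.
by rewrite /omitpt; ring.
Qed.
End Operator.

(** * When delta yields a polynomial *)
Section Admissible.
Variable F : finFieldType.
Local Notation q := #|F|.

Lemma hyppt_rel n d k (a : nat -> F) : (k <= d)%N -> a k = -1 ->
  (forall j, (k < j)%N -> a j = 0) -> \sum_(j < d.+1) a j *: hyppt n k a j = 0.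
Proof.
move=> kd ak a0; pose k' := Ordinal (kd : k < d.+1)%N.
rewrite (bigD1 k') //= ak scaleN1r {1}/hyppt {1}/upd eqxx.
rewrite (big_ord_widen d.+1 (fun i => a i *: genpt F n i)) ?(leqW kd) //.
rewrite [in X in - X]big_mkcond [in X in _ + X]big_mkcond /= -sumrN -big_split.
apply: big1 => j _ /=; rewrite -val_eqE /= /hyppt /upd.
case: ltngtP => [jk|kj|_] /=; rewrite ?oppr0 ?addr0 ?addNr //.
by rewrite a0 // scale0r addr0.
Qed.

(** On a hyperplane a_0 x_0 + ... + a_d x_d = 0, the minors in the numerator of
    delta_{d+1;b}(f) are proportional, up to signs, to the a_j. Up to a common minor,
    the sum below is therefore the value of the numerator, but it involves no
    determinants. The hyperplanes are those of the factors of L_{d+1}. *)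
Definition hyp_cond b d c (f : {mpoly F[c]}) := forall k (a : nat -> F),
  (k <= d)%N -> a k = -1 -> (forall j, (k < j)%N -> a j = 0) ->
  \sum_(j < d.+1) a j *:
     (hyppt c.+1 k a j ^+ (q ^ b) * ev f (omitpt j (hyppt c.+1 k a))) = 0.

Lemma hyp_cond1 b d c : hyp_cond b d (1 : {mpoly F[c]}).
Proof.
move=> k a kd ak a0; transitivity ((\sum_(j < d.+1) a j *: hyppt c.+1 k a j) ^+ (q ^ b)).
  by rewrite frob_sum; apply: eq_bigr => j _; rewrite ev1 mulr1 frobZ.
by rewrite hyppt_rel // frob0.
Qed.

(** The factors of L_{d+1} are among those of L_{d+2}. *)
Lemma hyp_condS b d c (f : {mpoly F[c]}) : hyp_cond b d.+1 f -> hyp_cond b d f.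
Proof.
move=> Hf k a kd ak a0; have := Hf k a (leqW kd) ak a0.
by rewrite big_ord_recr /= a0 // scale0r addr0.
Qed.

(** The numerator vanishes on the hyperplane of each factor of L_{d+1}, because
    the condition is a relation between its rows. *)
Lemma delta_exists b d c (f : {mpoly F[c]}) : (d <= c)%N -> hyp_cond b d f ->
  exists z, is_delta b d f z.
Proof.
move=> dc Hf.
have [k a kd ak a0|z zE] := @L_mdvd F c.+1 d.+1 (delta_num b d f (genpt F c.+1)) dc.
  rewrite ev_delta_num //; apply: (@bordered_det_eq0 _ _ _ _ _ _ a k) => //.
  - by rewrite ak oppr_eq0 oner_eq0.
  - exact: hyppt_rel.
  - exact: Hf.
by exists z; rewrite /is_delta zE.
Qed.

(** The Koszul relation at the generic point of a hyperplane is the condition on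
    z times a minor, and this minor is a nonzero Moore determinant. *)
Lemma hyp_cond_delta b d c (f : {mpoly F[c]}) z : (d <= c)%N -> is_delta b d f z ->
  hyp_cond b d.+1 z.
Proof.
move=> dc zE k a kd ak a0; set h := hyppt c.+2 k a.
have := delta_num_delta_eq0 h dc zE; rewrite delta_numE.
have ak0 : a k != 0 by rewrite ak oppr_eq0 oner_eq0.
have hr : \sum_(j < d.+2) a j *: h j = 0 by apply: hyppt_rel.
rewrite (eq_bigr (fun j : 'I_d.+2 => (- ((-1) ^+ (d.+1 + k) * L d.+1 (omitpt k h))) *
    (a j *: (h j ^+ (q ^ b) * ev z (omitpt j h))))); last first.
  move=> j _; have := moore_det_minor id kd (leq_ord j) ak0 hr.
  rewrite ak scaleN1r => /(canRL (@opprK _)) E.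
  transitivity ((-1) ^+ d.+1 * (h j ^+ (q ^ b) * ev z (omitpt j h)) *
                ((-1) ^+ j * L d.+1 (omitpt j h))).
    by rewrite exprD; ring.
  by rewrite E exprD -!mul_mpolyC; ring.
rewrite -mulr_sumr => /eqP; rewrite mulf_eq0 oppr_eq0 mulrI_eq0; last exact: lreg_sign.
rewrite (_ : L d.+1 (omitpt k h) = L d.+1 (omitpt k (genpt F c.+2))); last first.
  by apply: eq_moore_det => i _; rewrite /h omitpt_upd_same.
by rewrite (negPf (@L_omitpt_neq0 F c.+2 d.+1 k dc)) => /eqP.
Qed.

(** D_{d+1} is the quotient of these two determinants. The identity is required at
    every point because it is specialised to points of hyperplanes. *)
Definition is_dickson d c (D : {mpoly F[c]}) := forall n (v : nat -> {mpoly F[n]}),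
  L d.+1 v * ev D v = moore_det (bump d) d.+1 v.

Lemma delta_dickson d c (z : {mpoly F[c.+1]}) : (d <= c)%N ->
  is_delta d.+1 d (1 : {mpoly F[c]}) z -> is_dickson d z.
Proof.
move=> dc zE n v; rewrite (is_deltaE _ dc zE) moore_det_bordered.
rewrite /delta_num /bordered_det; congr (\det _).
apply/matrixP => j i; rewrite !mxE; case: ifP => id_.
  by rewrite /bump leqNgt id_.
by rewrite ev1 mulr1 /bump leqnn.
Qed.

(** On the hyperplane, the numerator and the denominator of D_{d+1} at the point
    without x_j are both proportional to a_j. So D_{d+1} takes the same value at all
    these points with a_j != 0, and can be taken out of the condition. *)
Lemma hyp_cond_dickson b d c e (f D : {mpoly F[c]}) : (d < c)%N -> is_dickson d D ->
  hyp_cond b d f -> hyp_cond b d (D ^+ e * f).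
Proof.
move=> dc DE Hf k a kd ak a0; set h := hyppt c.+1 k a.
have ak0 : a k != 0 by rewrite ak oppr_eq0 oner_eq0.
have kd1 : (k <= d.+1)%N by apply: leqW.
have hr : \sum_(j < d.+2) a j *: h j = 0 by apply: hyppt_rel.
have Lk0 : L d.+1 (omitpt k h) != 0.
  rewrite (_ : L d.+1 (omitpt k h) = L d.+1 (omitpt k (genpt F c.+1))) ?L_omitpt_neq0 //.
  by apply: eq_moore_det => i _; rewrite /h omitpt_upd_same.
have DjE j : (j <= d)%N -> a j != 0 -> ev D (omitpt j h) = ev D (omitpt k h).
  move=> jd aj; have jd1 : (j <= d.+1)%N by apply: leqW.
  have E1 := moore_det_minor id kd1 jd1 ak0 hr.
  have E2 := moore_det_minor (bump d) kd1 jd1 ak0 hr.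
  move: E2; rewrite -!DE !mulrA [LHS]scalerAl [RHS]scalerAl E1 -!scalerAl => /eqP.
  rewrite -subr_eq0 -scalerBr -mulrBr scaler_eq0 (negPf aj) /= !mulf_eq0.
  by rewrite signr_eq0 (negPf Lk0) /= subr_eq0 => /eqP.
rewrite (eq_bigr (fun j : 'I_d.+1 => ev D (omitpt k h) ^+ e *
    (a j *: (h j ^+ (q ^ b) * ev f (omitpt j h))))); last first.
  move=> j _; have [->|aj] := eqVneq (a j) 0; first by rewrite !scale0r mulr0.
  by rewrite evM evX DjE ?leq_ord // mulrCA -scalerAr.
by rewrite -mulr_sumr Hf // mulr0.
Qed.

(** * Symmetries of delta *)
Definition torus_inv c (f : {mpoly F[c]}) := forall n (v : nat -> {mpoly F[n]}) k (t : F),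
  t != 0 -> ev f (upd v k (t *: v k)) = ev f v.

(** The ideal generated by all x_i ^ (q ^ b) is not preserved by delta_{d+1;b}, since
    the division by L can lead out of it. What is preserved is that the substitution
    x_k := x_k + t x_l changes f by a multiple of the power of x_l alone. *)
Definition transv_inv b c (f : {mpoly F[c]}) := forall n (v : nat -> {mpoly F[n]}) k l (t : F),
  (l < k)%N -> mdvd (v l ^+ (q ^ b)) (ev f (upd v k (v k + t *: v l)) - ev f v).

Lemma ev_upd_ge c n (f : {mpoly F[c]}) (v : nat -> {mpoly F[n]}) k x :
  (c <= k)%N -> ev f (upd v k x) = ev f v.
Proof.
move=> ck; apply: eq_ev => i ic; rewrite /upd ifN //.
by apply: contraTneq ic => ->; rewrite -leqNgt.
Qed.

Lemma ev_upd_genpt c n (f : {mpoly F[c]}) (v : nat -> {mpoly F[n]}) k x :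
  ev (ev f (upd (genpt F c) k x)) v = ev f (upd v k (ev x v)).
Proof.
by rewrite ev_comp; apply: eq_ev => i ic; rewrite /upd; case: eqP => // _; rewrite ev_genpt.
Qed.

Lemma torus_inv_genpt c (f : {mpoly F[c]}) :
  (forall k t, (k < c)%N -> t != 0 ->
     ev f (upd (genpt F c) k (t *: genpt F c k)) = f) -> torus_inv f.
Proof.
move=> Hf n v k t t0; case: (ltnP k c) => [kc|ck]; last by rewrite ev_upd_ge.
by rewrite -{2}(Hf k t kc t0) ev_upd_genpt evZ ev_genpt.
Qed.

Lemma transv_inv_genpt b c (f : {mpoly F[c]}) :
  (forall k l t, (l < k)%N -> (k < c)%N -> mdvd (genpt F c l ^+ (q ^ b))
      (ev f (upd (genpt F c) k (genpt F c k + t *: genpt F c l)) - f)) -> transv_inv b f.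
Proof.
move=> Hf n v k l t lk; case: (ltnP k c) => [kc|ck]; last first.
  by rewrite ev_upd_ge // subrr; apply: mdvd0.
have lc := ltn_trans lk kc.
have := mdvd_ev v (Hf k l t lk kc).
by rewrite evB ev_upd_genpt evD evZ evX !ev_genpt.
Qed.

Lemma delta_num_torus b d c (f : {mpoly F[c]}) n (v : nat -> {mpoly F[n]}) k t :
  torus_inv f -> t != 0 ->
  delta_num b d f (upd v k (t *: v k)) = (if (k <= d)%N then t else 1) *: delta_num b d f v.
Proof.
move=> Tf t0; rewrite !delta_numE scaler_sumr; apply: eq_bigr => j _.
have [jk|jk] := eqVneq (j : nat) k.
  rewrite -jk leq_ord /upd eqxx -/(upd _ _ _).
  rewrite (@eq_ev _ _ _ f _ (omitpt j v)); last by move=> i _; apply: omitpt_upd_same.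
  rewrite (@eq_moore_det _ _ _ _ _ (omitpt j v)); last by move=> i _; apply: omitpt_upd_same.
  by rewrite frobZ -scalerAl -scalerAr -scalerAl.
have kj : k != j by rewrite eq_sym.
have E : omitpt j (upd v k (t *: v k)) =1
    upd (omitpt j v) (unbump j k) (t *: omitpt j v (unbump j k)).
  by move=> i; rewrite omitpt_upd // omitpt_unbump.
rewrite (@eq_ev _ _ _ f _ _ (fun i _ => E i)) (@eq_moore_det _ _ _ _ _ _ (fun i _ => E i)).
rewrite Tf // {1}/upd (negPf jk); have jd := leq_ord j.
case: leqP => kd; first by rewrite moore_det_updZ ?scalerAr // /unbump; lia.
by rewrite moore_det_upd_ge ?scale1r // /unbump; lia.
Qed.

Lemma torus_inv_delta b d c (f : {mpoly F[c]}) z : (d <= c)%N -> is_delta b d f z ->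
  torus_inv f -> torus_inv z.
Proof.
move=> dc zE Tf; apply: torus_inv_genpt => k t kc t0; set X := genpt F c.+1.
have := is_deltaE (upd X k (t *: X k)) dc zE; rewrite delta_num_torus // -/X -zE.
rewrite (_ : L _ _ = (if (k <= d)%N then t else 1) *: L d.+1 X); last first.
  by case: leqP => kd; [rewrite moore_det_updZ | rewrite moore_det_upd_ge // scale1r].
have s0 : (if (k <= d)%N then t else 1) != 0 by case: (k <= d)%N; rewrite ?oner_eq0.
rewrite -scalerAl => /(scalerI s0).
exact/mulfI/L_genpt_neq0.
Qed.

Lemma mdvd_L n d (v : nat -> {mpoly F[n]}) l : (l < d)%N -> mdvd (v l) (L d v).
Proof.
by case: d => // d ld; have [u ->] := L_factor v (ld : (l <= d)%N); apply/mdvdMr/mdvdxx.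
Qed.

(** If x_l occurs in L_{d+1}, it also divides the minors in which it is not omitted,
    and the term where it is omitted changes by a multiple of x_l. This gives one
    factor x_l more than the power, which makes up for the division by L_{d+1}. *)
Lemma delta_num_transv b d c (f : {mpoly F[c]}) n (v : nat -> {mpoly F[n]}) k l t :
  transv_inv b f -> (l < k)%N ->
  mdvd (v l ^+ (q ^ b) * v l ^+ (l <= d))
       (delta_num b d f (upd v k (v k + t *: v l)) - delta_num b d f v).
Proof.
move=> Qf lk; rewrite !delta_numE -sumrB; apply: mdvd_sum => j _.
set v' := upd v k _; have jd := leq_ord j.
rewrite -!mulrA -mulrBr; apply: mdvdMl.
(* the term in which x_k is omitted: only the power x_j ^ (q ^ b) changes *)
have [jk|jk] := eqVneq (j : nat) k.
  have ld : (l <= d)%N by lia.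
  rewrite (@eq_ev _ _ _ f (omitpt j v') (omitpt j v)); last first.
    by move=> i _; rewrite /v' -jk omitpt_upd_same.
  rewrite (@eq_moore_det _ _ _ _ (omitpt j v') (omitpt j v)); last first.
    by move=> i _; rewrite /v' -jk omitpt_upd_same.
  rewrite -mulrBl; apply: mdvdM.
    by rewrite /v' /upd jk eqxx frobD frobZ addrAC subrr add0r -mul_mpolyC; apply/mdvdMl/mdvdxx.
  apply: mdvdMl; rewrite ld expr1 -(omitpt_unbump v (_ : l != j)); last lia.
  by apply: mdvd_L; rewrite /unbump; lia.
have v'j : v' j = v j by rewrite /v' /upd (negPf jk).
rewrite v'j.
(* the term in which x_l is omitted: the power of x_l is in front *)
have [jl|jl] := eqVneq (j : nat) l.
  have ld : (l <= d)%N by lia.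
  rewrite -mulrBr jl; apply: mdvdM; first exact: mdvdxx.
  rewrite ld expr1.
  have dvi i : mdvd (v l) (omitpt l v' i - omitpt l v i).
    rewrite /omitpt /v' /upd; case: eqP => [->|_]; last by rewrite subrr; apply: mdvd0.
    by rewrite addrAC subrr add0r -mul_mpolyC; apply/mdvdMl/mdvdxx.
  have [u Eu] : mdvd (v l) (ev f (omitpt l v') - ev f (omitpt l v)) by apply: ev_cong => i _.
  have [w Ew] : mdvd (v l) (L d (omitpt l v') - L d (omitpt l v)).
    rewrite -(@ev_moore_det_genpt F id d d n (omitpt l v')) //.
    rewrite -(@ev_moore_det_genpt F id d d n (omitpt l v)) //.
    by apply: ev_cong => i _.
  exists (u * L d (omitpt l v') + ev f (omitpt l v) * w).
  rewrite mulrDr mulrA -Eu mulrCA -Ew mulrBl mulrBr addrA subrK.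
  by [].
(* the other terms: the hypothesis on f supplies the power of x_l *)
have kj : k != j by rewrite eq_sym.
have lj : l != j by rewrite eq_sym.
have lk' : (unbump j l < unbump j k)%N by rewrite /unbump; lia.
have E : omitpt j v' =1 upd (omitpt j v) (unbump j k)
    (omitpt j v (unbump j k) + t *: omitpt j v (unbump j l)).
  by move=> i; rewrite omitpt_upd // !omitpt_unbump.
rewrite (@eq_ev _ _ _ f _ (upd (omitpt j v) (unbump j k)
    (omitpt j v (unbump j k) + t *: omitpt j v (unbump j l)))); last first.
  by move=> i _; apply: E.
rewrite (@eq_moore_det _ _ _ _ _ (upd (omitpt j v) (unbump j k)
    (omitpt j v (unbump j k) + t *: omitpt j v (unbump j l)))); last first.
  by move=> i _; apply: E.
rewrite (_ : moore_det id d (upd _ _ _) = moore_det id d (omitpt j v)); last first.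
  case: (ltnP (unbump j k) d) => kd; last by rewrite moore_det_upd_ge.
  rewrite moore_det_updD // ?(ltn_trans lk') //; lia.
rewrite -mulrBr -mulrBl; apply: mdvdMl; apply: mdvdM.
  by have := Qf _ (omitpt j v) _ _ t lk'; rewrite (omitpt_unbump v lj).
case: leqP => ld; last by exists (L d (omitpt j v)); rewrite mul1r.
rewrite expr1 -(omitpt_unbump v lj); apply: mdvd_L; rewrite /unbump; lia.
Qed.

End Admissible.

Section Symmetry.
Variable F : finFieldType.
Local Notation q := #|F|.
Local Notation "p %:F" := (FracField.tofrac p).

Lemma mdvd_genpt n l (y : {mpoly F[n]}) :
  ev y (upd (genpt F n) l 0) = 0 -> mdvd (genpt F n l) y.
Proof.
move=> y0; have [u] := ev_upd y (genpt F n) l 0.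
by rewrite y0 ev_id !sub0r mulNr => /oppr_inj ->; exists u.
Qed.

Lemma genpt_neq0 n l : (l < n)%N -> genpt F n l != 0.
Proof.
move=> ln; apply/eqP => /(congr1 (mcoeff U_(Ordinal ln))) /eqP.
by rewrite mcoeff_genpt mcoeff0 eqxx oner_eq0.
Qed.

(** The variable x_l is prime and does not divide M. *)
Lemma mdvd_cancel n l e (M y : {mpoly F[n]}) : (l < n)%N ->
  ev M (upd (genpt F n) l 0) != 0 ->
  mdvd (genpt F n l ^+ e) (M * y) -> mdvd (genpt F n l ^+ e) y.
Proof.
move=> ln M0; elim: e y => [|e IH] y; first by exists y; rewrite mul1r.
move=> [u uE]; have [w yE] : mdvd (genpt F n l) y.
  apply: mdvd_genpt; move/(congr1 (fun p => ev p (upd (genpt F n) l 0))): uE.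
  rewrite !evM exprS evM ev_genpt // upd_eq !mul0r => /eqP.
  by rewrite mulf_eq0 (negPf M0) => /eqP.
rewrite yE exprS; apply: mdvdM; first exact: mdvdxx.
apply: IH; exists u; apply: (mulfI (genpt_neq0 ln)).
by rewrite mulrCA -yE uE exprS mulrA.
Qed.

Lemma ev_omitpt_genpt n l i : (i.+1 < n)%N ->
  ev (omitpt l (genpt F n) i) (upd (genpt F n) l 0) = omitpt l (genpt F n) i.
Proof.
move=> ic; rewrite /omitpt ev_genpt; last by rewrite /bump; lia.
by rewrite /upd eq_sym (negPf (neq_bump _ _)).
Qed.

(** L_{d+1} contains the factor x_l once if l <= d, and otherwise not at all. *)
Lemma transv_inv_delta b d c (f : {mpoly F[c]}) z : (d <= c)%N -> is_delta b d f z ->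
  transv_inv b f -> transv_inv b z.
Proof.
move=> dc zE Qf; apply: transv_inv_genpt => k l t lk kc; set X := genpt F c.+1.
have lc := ltn_trans lk kc.
set X' := upd X k _; have := delta_num_transv d X t Qf lk.
rewrite -/X' -zE -(is_deltaE _ dc zE).
have -> : L d.+1 X' = L d.+1 X.
  case: (ltnP k d.+1) => kd; last by rewrite moore_det_upd_ge.
  by rewrite moore_det_updD ?(ltn_trans lk) // neq_ltn lk.
rewrite -mulrBr; set y := _ - z.
have [M LE M0] : exists2 M, L d.+1 X = X l ^+ (l <= d) * M & ev M (upd X l 0) != 0.
  case: leqP => ld; last first.
    exists (L d.+1 X); first by rewrite mul1r.
    by rewrite ev_moore_det_genpt // moore_det_upd_ge // L_genpt_neq0.
  have [u ->] := L_factor X ld; rewrite expr1.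
  exists ((-1) ^+ l * L d (omitpt l X) ^+ q + X l * u) => //.
  rewrite evD !evM ev_genpt // upd_eq mul0r addr0 !evX ev_moore_det.
  rewrite (@eq_moore_det _ _ _ _ _ (omitpt l X)); last first.
    by move=> i id_; apply: ev_omitpt_genpt; lia.
  rewrite mulf_neq0 ?expf_neq0 ?L_omitpt_neq0 // -scaleN1r evZ ev1.
  by rewrite scaleN1r oppr_eq0 oner_eq0.
rewrite LE => -[u uE]; have E : M * y = X l ^+ (q ^ b) * u.
  apply: (mulfI (expf_neq0 (l <= d) (genpt_neq0 lc))).
  by rewrite mulrA uE -/X; ring.
by apply: (mdvd_cancel lc M0); exists u.
Qed.

Lemma dickson_genpt d c (D : {mpoly F[c]}) : is_dickson d D ->
  L d.+1 (genpt F c) * D = moore_det (bump d) d.+1 (genpt F c).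
Proof. by move=> DE; rewrite -DE ev_id. Qed.

Lemma dickson_torus d c (D : {mpoly F[c]}) : (d < c)%N -> is_dickson d D -> torus_inv D.
Proof.
move=> dc DE; apply: torus_inv_genpt => k t _ t0; apply: (mulfI (L_genpt_neq0 F dc)).
rewrite (dickson_genpt DE); case: (ltnP k d.+1) => kd; last first.
  by rewrite -(moore_det_upd_ge id _ (t *: genpt F c k) kd) DE moore_det_upd_ge.
apply: (scalerI t0); rewrite scalerAl -(moore_det_updZ id _ t kd).
by rewrite -(moore_det_updZ (bump d) _ t kd) DE.
Qed.

Lemma dickson_transv d c (D : {mpoly F[c]}) n (v : nat -> {mpoly F[n]}) k l t :
  (d < c)%N -> is_dickson d D -> (l < k)%N ->
  ev D (upd v k (v k + t *: v l)) = ev D v.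
Proof.
move=> dc DE lk; case: (ltnP k c) => kc; last by rewrite ev_upd_ge.
have lc := ltn_trans lk kc.
suff DX : ev D (upd (genpt F c) k (genpt F c k + t *: genpt F c l)) = D.
  by rewrite -[in RHS]DX ev_upd_genpt evD evZ !ev_genpt.
apply: (mulfI (L_genpt_neq0 F dc)).
rewrite (dickson_genpt DE); case: (ltnP k d.+1) => kd; last first.
  by rewrite -(moore_det_upd_ge id _ (genpt F c k + t *: genpt F c l) kd) DE moore_det_upd_ge.
have ld := ltn_trans lk kd; have nlk : l != k by rewrite neq_ltn lk.
by rewrite -(moore_det_updD _ _ t kd ld nlk) DE moore_det_updD.
Qed.

(** The invariant of the inductive construction of the Y_b(I; J), started with f = 1. *)
Definition admissible b d c (f : {mpoly F[c]}) :=
  [/\ hyp_cond b d f, torus_inv f & transv_inv b f].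

Lemma admissible1 b d c : admissible b d (1 : {mpoly F[c]}).
Proof.
split=> [|n v k t _|n v k l t _]; first exact: hyp_cond1; first by rewrite !ev1.
by rewrite !ev1 subrr; apply: mdvd0.
Qed.

Lemma admissible_delta b d c (f : {mpoly F[c]}) z : (d <= c)%N -> is_delta b d f z ->
  admissible b d f -> admissible b d z.
Proof.
move=> dc zE [_ Tf Qf]; split; first exact/hyp_condS/hyp_cond_delta/zE.
  exact: torus_inv_delta zE Tf.
exact: transv_inv_delta zE Qf.
Qed.

Lemma admissible_dickson b d c e (f D : {mpoly F[c]}) : (d < c)%N -> is_dickson d D ->
  admissible b d.+1 f -> admissible b d (D ^+ e * f).
Proof.
move=> dc DE [Hf Tf Qf]; split; first exact: hyp_cond_dickson (hyp_condS Hf).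
  by move=> n v k t t0; rewrite !evM !evX Tf // (dickson_torus dc DE).
move=> n v k l t lk; rewrite !evM !evX (dickson_transv _ _ dc DE) // -mulrBr.
exact/mdvdMl/Qf.
Qed.

(** * Lifting the Frobenius map *)
(** For f = Y and f' = Phi(Y), this says that the lowest slice of Phi(Y) along x_0
    is Y ^ q. *)
Definition frob_lift c (f' : {mpoly F[c.+1]}) (f : {mpoly F[c]}) :=
  forall n (v : nat -> {mpoly F[n]}), v 0%N = 0 -> ev f' v = ev f (omitpt 0 v) ^+ q.

Lemma frob_lift1 c : frob_lift (1 : {mpoly F[c.+1]}) (1 : {mpoly F[c]}).
Proof. by move=> n v _; rewrite !ev1 expr1n. Qed.

Lemma frob_liftM c (f' g' : {mpoly F[c.+1]}) f g :
  frob_lift f' f -> frob_lift g' g -> frob_lift (f' * g') (f * g).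
Proof. by move=> rf rg n v v0; rewrite !evM rf // rg // exprMn. Qed.

Lemma frob_liftX c (f' : {mpoly F[c.+1]}) f e : frob_lift f' f -> frob_lift (f' ^+ e) (f ^+ e).
Proof. by move=> rf n v v0; rewrite !evX rf // exprAC. Qed.

(** The numerator and the denominator of z' are divisible by the first variable.
    By L_factor, after this division and with the first variable set to 0, they become
    the q-th powers of the numerator and of the denominator of z. *)
Lemma frob_lift_delta b d c (f' : {mpoly F[c.+1]}) f z z' : (d <= c)%N ->
  frob_lift f' f -> is_delta b d f z -> is_delta b.+1 d.+1 f' z' -> frob_lift z' z.
Proof.
move=> dc rf zE zE'; set X := genpt F c.+2; set X0 := upd X 0 0.
suff H : ev z' X0 = ev z (omitpt 0 X) ^+ q.
  move=> n v v0; transitivity (ev (ev z' X0) v).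
    by rewrite ev_upd_genpt ev0; apply: eq_ev => -[|i] _; rewrite /upd //= v0.
  rewrite H evX ev_comp; congr (_ ^+ _); apply: eq_ev => i ic.
  by rewrite /omitpt ev_genpt // /bump; lia.
(* S is the numerator of z', divided by x_0, up to multiples of x_0. *)
pose S := \sum_(i < d.+1) (-1) ^+ (d + i) *
  (X i.+1 ^+ (q ^ b.+1) * ev f' (omitpt i.+1 X)) * L d (omitpt 0 (omitpt i.+1 X)) ^+ q.
have [u LE] : exists u, L d.+2 X = X 0%N * (L d.+1 (omitpt 0 X) ^+ q + X 0%N * u).
  by have [u ->] := L_factor X (leq0n d.+1); exists u; rewrite mul1r.
have [w NE] : mdvd (X 0%N * X 0%N) (delta_num b.+1 d.+1 f' X - X 0%N * S).
  rewrite delta_numE big_ord_recl /= -addrA; apply: mdvdD.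
    apply/mdvdMr/mdvdMl/mdvdMr; have -> : (q ^ b.+1 = (q ^ b.+1 - 2) + 2)%N.
      rewrite subnK // (leq_trans (qgt1 F)) // expnS leq_pmulr ?qe_gt0 //.
    by rewrite exprD expr2; apply/mdvdMl/mdvdxx.
  rewrite mulr_sumr -sumrB; apply: mdvd_sum => i _; rewrite /= /bump leq0n add1n.
  have [t ->] := L_factor (omitpt i.+1 X) (leq0n d).
  have -> : omitpt i.+1 X 0 = X 0%N by [].
  exists ((-1) ^+ (d + i) * (X i.+1 ^+ (q ^ b.+1) * ev f' (omitpt i.+1 X)) * t).
  by rewrite addSnnS !addnS !exprS; ring.
have x0 : X 0%N != 0 by apply: genpt_neq0.
have E : (L d.+1 (omitpt 0 X) ^+ q + X 0%N * u) * z' = S + X 0%N * w.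
  apply: (mulfI x0); rewrite mulrA -LE zE' mulrDr mulrA -NE addrC subrK //.
have X00 : X0 0%N = 0 by [].
have bmp0 : omitpt 0 X0 =1 omitpt 0 X by apply: omitpt_upd_same.
have evL v : (forall i, (i <= c)%N -> ev (v i) X0 = v i) -> forall e k, (k <= c.+1)%N ->
   ev (moore_det e k v) X0 = moore_det e k v.
  move=> vX e k kc; rewrite ev_moore_det; apply: eq_moore_det => i ik; apply: vX; lia.
have bX i : (i <= c)%N -> ev (omitpt 0 X i) X0 = omitpt 0 X i.
  by move=> ic; apply: ev_omitpt_genpt.
have evX0 : ev (X 0%N) X0 = 0 by rewrite ev_genpt.
move/(congr1 (fun p => ev p X0)): E; rewrite !(evM, evD) evX0 !mul0r !addr0 evX evL //.
have -> : ev S X0 = (delta_num b d f (omitpt 0 X)) ^+ q.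
  rewrite delta_numE frobq_sum ev_sum; apply: eq_bigr => i _.
  have ic : (i <= c)%N by apply: leq_trans (leq_ord i) dc.
  have bb (v : nat -> {mpoly F[c.+2]}) j : omitpt 0 (omitpt i.+1 v) j = omitpt i (omitpt 0 v) j.
    by rewrite /omitpt; congr (v _); rewrite /bump; lia.
  rewrite !evM !evX !exprMn !ev_genpt // ev_moore_det.
  rewrite (@eq_moore_det _ _ _ _ _ (omitpt i (omitpt 0 X))); last first.
    by move=> j jd; rewrite bb /omitpt; apply: bX; rewrite /bump; lia.
  congr (_ * (_ * _) * _).
  - by rewrite -scaleN1r evZ ev1 scaleN1r -exprM mulnC exprM -scaleN1r -[q]expn1 frobZ expr1n.
  - by rewrite /X0 /upd /= /omitpt -exprM expnSr.
  - rewrite ev_comp (@eq_ev _ _ _ f' _ (omitpt i.+1 X0)); last first.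
      by move=> j jc; rewrite /omitpt ev_genpt // /bump; lia.
    rewrite rf //; congr (_ ^+ _); apply: eq_ev => j jc.
    by rewrite bb /omitpt; apply: bmp0.
rewrite -(is_deltaE _ dc zE) exprMn; apply: mulfI.
by rewrite expf_neq0 // L_omitpt_neq0 // ltnS.
Qed.

Lemma omit_poly c (j : 'I_c.+1) (f : {mpoly F[c]}) :
  omit j (f%:F) = (poly_omit j f)%:F.
Proof.
have {1}-> : f%:F = f%:F / 1%:F by rewrite tofrac1 divr1.
by rewrite omit_frac ?oner_eq0 // /poly_omit rmorph1 tofrac1 divr1.
Qed.

(** The determinants over the field of fractions are the images of L and of the
    numerator. *)
Lemma delta_tofrac b d c (f : {mpoly F[c]}) z : (d <= c)%N -> is_delta b d f z ->
  delta d.+1 b (f%:F) = z%:F.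
Proof.
move=> dc zE; rewrite /delta.
have rE j : (j < d.+1)%N -> rvar F (inord j : 'I_c.+1) = (genpt F c.+1 j)%:F.
  move=> jd; rewrite /rvar -genpt_ord inordK //; exact: leq_trans dc.
have -> : \det (moore F c d.+1) = (L d.+1 (genpt F c.+1))%:F.
  rewrite -det_tr -det_map_mx; congr (\det _); apply/matrixP => j i.
  by rewrite !mxE rE ?rmorphXn.
have -> : \det (Defs.delta_mx d.+1 b (f%:F : ratfun F c)) = (delta_num b d f (genpt F c.+1))%:F.
  rewrite -det_tr -det_map_mx; congr (\det _); apply/matrixP => j i.
  rewrite !mxE ltnS rE //; case: ifP => _; first by rewrite rmorphXn.
  rewrite rmorphM rmorphXn /=; congr (_ * _).
  rewrite omit_poly /poly_omit.
  congr (_%:F); rewrite evE; congr (f \mPo _); apply: eq_mktuple => k.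
  rewrite -genpt_ord /omitpt /= inordK //; apply: leq_trans (ltn_ord j) _.
  by rewrite ltnS.
rewrite -zE rmorphM /= mulrC mulKf // tofrac_eq0.
exact: L_genpt_neq0.
Qed.

End Symmetry.

(** * The polynomials Y_b(I; J) *)
Section PolynomialsY.
Variable F : finFieldType.
Local Notation q := #|F|.
Local Notation "p %:F" := (FracField.tofrac p).

Lemma admissible_delta_ex b d c (f : {mpoly F[c]}) : (d <= c)%N -> admissible b d f ->
  exists z, [/\ is_delta b d f z, delta d.+1 b (f%:F) = z%:F & admissible b d z].
Proof.
move=> dc gf; have [Hf _ _] := gf; have [z zE] := delta_exists dc Hf.
by exists z; split=> //; [apply: delta_tofrac | apply: admissible_delta zE gf].
Qed.

(** Y_b and its lift with b, and all orders of operators, raised by 1 are built in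
    parallel, from the inside out. The hyperplane condition for d + 1 on the inner
    expression implies that for d, which powers of D_{d+1} and delta_{d+1;b} preserve. *)
Lemma Yrec_poly b IJ d c : c = (d + size IJ + sumn (unzip1 IJ))%N ->
  exists f f', [/\ Yrec F b d.+1 IJ c = f%:F, Yrec F b.+1 d.+2 IJ c.+1 = f'%:F,
                   admissible b d f, admissible b.+1 d.+1 f' & frob_lift f' f].
Proof.
elim: IJ d c => [|[i j] IJ IH] d c /=.
  move=> _; exists 1, 1; split; rewrite /= ?tofrac1 //; first exact: admissible1.
    exact: admissible1.
  exact: frob_lift1.
set e := (d + size IJ + sumn (unzip1 IJ))%N => ->.
have -> : (d + (size IJ).+1 + (i + sumn (unzip1 IJ)) = i + e.+1)%N by rewrite /e; lia.
have de : (d <= e)%N by rewrite /e; lia.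
have [|g [g' [gE gE' gg gg' rg]]] := IH d.+1 e.+1; first by rewrite /e; lia.
have [D [DE Df gD]] := admissible_delta_ex de (admissible1 F d.+1 d e).
have [D' [DE' Df' gD']] :=
  admissible_delta_ex (de : (d.+1 <= e.+1)%N) (admissible1 F d.+2 d.+1 e.+1).
have rD : frob_lift D' D by apply: frob_lift_delta de _ DE DE'; apply: frob_lift1.
elim: i => [|i [f [f' [fE fE' gf gf' rf]]]].
  exists (D ^+ j * g), (D' ^+ j * g'); split.
  - by rewrite /= gE rmorphM rmorphXn /= -Df tofrac1.
  - by rewrite /= gE' rmorphM rmorphXn /= -Df' tofrac1.
  - exact: admissible_dickson (delta_dickson de DE) gg.
  - exact: admissible_dickson (delta_dickson (de : (d.+1 <= e.+1)%N) DE') gg'.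
  - exact: frob_liftM (frob_liftX _ rD) rg.
have die : (d <= i + e.+1)%N by lia.
have [z [zE zf gz]] := admissible_delta_ex die gf.
have [z' [zE' zf' gz']] := admissible_delta_ex (die : (d.+1 <= (i + e.+1).+1)%N) gf'.
exists z, z'; split.
- by rewrite -zf -fE; reflexivity.
- by rewrite -zf' -fE'; reflexivity.
- exact: gz.
- exact: gz'.
- exact: frob_lift_delta die rf zE zE'.
Qed.

Lemma mdvd_ideal b c (r : 'I_c) (x : {mpoly F[c]}) :
  mdvd (genpt F c r ^+ (q ^ b)) x -> x \in @trunc_ideal F b c.
Proof. by case=> u ->; rewrite mulrC genpt_ord; apply/idealMr/trunc_idealX. Qed.

(** While x_0, ..., x_{k-1} are still in place, x_k is first scaled and then
    increased by multiples of one earlier variable at a time. *)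
Lemma ev_upd_coord_ideal b c (f : {mpoly F[c]}) (v : nat -> {mpoly F[c]}) (k r : nat)
    (t : F) (a : nat -> F) :
  torus_inv f -> transv_inv b f -> (k < c)%N -> (r <= k)%N -> t != 0 ->
  (forall l, (l <= k)%N -> v l = genpt F c l) ->
  ev f (upd v k (t *: genpt F c k + \sum_(l < r) a l *: genpt F c l)) - ev f v
    \in @trunc_ideal F b c.
Proof.
move=> Tf Qf kc rk t0 vX; elim: r rk => [|r IH] rk.
  by rewrite big_ord0 addr0 -vX // Tf // subrr rpred0.
set v1 := upd v k _ in IH.
have rc : (r < c)%N by apply: ltn_trans kc.
rewrite -(subrK (ev f v1) (ev f _)) -addrA; apply: rpredD; last exact/IH/ltnW.
apply: (@mdvd_ideal b c (Ordinal rc)) => /=.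
have := Qf _ v1 k r (a r) rk.
have -> : v1 r = genpt F c r by rewrite /v1 /upd ltn_eqF // vX // ltnW.
rewrite /v1 upd_eq big_ord_recr /= addrA => H.
set x := _ + a r *: _ in H *; rewrite (@eq_ev _ _ _ f _ (upd v1 k x)) // => i _.
by rewrite /v1 /upd; case: eqP.
Qed.

Lemma borel_diag c (s : 'M[F]_c) : s \in borel F c -> forall i, s i i != 0.
Proof.
rewrite inE => /andP[su /forallP st] i.
have tr : is_trig_mx s^T.
  apply/is_trig_mxP => j k jk; rewrite mxE; apply/eqP.
  by have /forallP/(_ j)/implyP/(_ jk) := st k.
move: su; rewrite unitmxE unitfE -det_tr det_trig // => /prodf_neq0/(_ i isT).
by rewrite mxE.
Qed.

(** An upper triangular substitution is performed one coordinate at a time, from the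
    last to the first. The new value of x_k involves only variables that have not been
    changed yet, so that elementary steps suffice. *)
Lemma borel_invariants_pi b c (f : {mpoly F[c]}) : torus_inv f -> transv_inv b f ->
  \pi_(trunc_ring F b c) f \in borel_invariants F b c.
Proof.
move=> Tf Qf; apply/borel_invariantsP => s sB; rewrite trunc_act_pi; apply/pi_trunc_eq.
pose w (j : nat) := if insub j is Some j' then \sum_i s i j' *: 'X_i else 0 : {mpoly F[c]}.
have -> : mx_act s f = ev f w.
  by rewrite evE; congr (f \mPo _); apply: eq_mktuple => j; rewrite /w valK.
(* v k is the intermediate point at which the coordinates from k on are new. *)
pose v k i := if (i < k)%N then genpt F c i else w i.
suff H k : (k <= c)%N -> ev f (v (c - k)%N) - f \in @trunc_ideal F b c.
  have := H c (leqnn c); rewrite subnn (@eq_ev _ _ _ f (v 0%N) w) //.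
elim: k => [|k IH] kc.
  rewrite subn0 (@eq_ev _ _ _ f _ (genpt F c)) ?ev_id ?subrr ?rpred0 //.
  by move=> i ic; rewrite /v ic.
rewrite -(subrK (ev f (v (c - k)%N)) (ev f (v _))) -addrA; apply: rpredD; last exact/IH/ltnW.
set m := (c - k.+1)%N; have mc : (m < c)%N by rewrite /m; lia.
have -> : (c - k)%N = m.+1 by rewrite /m; lia.
pose M := Ordinal mc; pose a (l : nat) := if insub l is Some o then s o M else 0.
have sM0 := borel_diag sB M.
have vX l : (l <= m)%N -> v m.+1 l = genpt F c l by move=> lm; rewrite /v ltnS lm.
have := @ev_upd_coord_ideal b c f (v m.+1) m m (s M M) a Tf Qf mc (leqnn m) sM0 vX.
rewrite (@eq_ev _ _ _ f _ (v m)) // => i ic; rewrite /upd /v.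
rewrite ltnS leq_eqVlt; case: (ltngtP i m) => [im|mi|im] //=.
rewrite /w im insubT /=; have -> : Sub m mc = M by [].
rewrite (bigD1 M) //= -genpt_ord; congr (_ + _).
rewrite (big_ord_widen c (fun l => a l *: genpt F c l)) ?(ltnW mc) //.
rewrite big_mkcond [RHS]big_mkcond; apply: eq_bigr => l _ /=.
rewrite -val_eqE /= /a valK genpt_ord; case: ltngtP => // ml.
move: sB; rewrite inE => /andP[_ /forallP/(_ l)/forallP/(_ M)/implyP/(_ ml)/eqP ->].
by rewrite scale0r.
Qed.

End PolynomialsY.

(** * Slices along the first variable *)
Section Slice.
Variable F : finFieldType.
Local Notation q := #|F|.

Lemma trunc_ideal_coef m n (p : {mpoly F[n]}) :
  reflect (forall k : 'X_{1..n}, (forall i, k i < q ^ m)%N -> p@_k = 0)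
    (p \in @trunc_ideal F m n).
Proof.
apply: (iffP (trunc_idealP m p)) => [p0 k kq|p0 e]; last first.
  by apply: p0 => i; rewrite mnmE.
rewrite -(p0 [ffun i => Ordinal (kq i)]); congr (_@_ _).
by apply/mnmP => i; rewrite mnmE ffunE.
Qed.

Variable n : nat.

Definition polyX0_var (i : 'I_n.+1) : {poly {mpoly F[n]}} :=
  if unlift ord0 i is Some j then ('X_j)%:P else 'X.

(** The isomorphism with polynomials in x_0 over polynomials in the other
    variables. *)
Definition polyX0 : {rmorphism {mpoly F[n.+1]} -> {poly {mpoly F[n]}}} :=
  mmap (polyC \o @mpolyC n F) polyX0_var.

Definition slice e p : {mpoly F[n]} := (polyX0 p)`_e.

Lemma polyX0C a : polyX0 a%:MP = (a%:MP)%:P.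
Proof. by rewrite /polyX0 /= mmapC. Qed.
Lemma polyX0_var0 : polyX0 'X_ord0 = 'X.
Proof. by rewrite /polyX0 /= mmapX mmap1U /polyX0_var unlift_none. Qed.
Lemma polyX0_varS j : polyX0 'X_(lift ord0 j) = ('X_j)%:P.
Proof. by rewrite /polyX0 /= mmapX mmap1U /polyX0_var liftK. Qed.
Lemma polyX0Z a p : polyX0 (a *: p) = (a%:MP)%:P * polyX0 p.
Proof. by rewrite -mul_mpolyC rmorphM polyX0C. Qed.

Lemma slice_linear e : linear (slice e).
Proof. by move=> a p r; rewrite /slice rmorphD polyX0Z coefD coefCM mul_mpolyC. Qed.

Lemma sliceB e p r : slice e (p - r) = slice e p - slice e r.
Proof. by rewrite /slice rmorphB coefB. Qed.

Lemma sliceD e p r : slice e (p + r) = slice e p + slice e r.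
Proof. by rewrite /slice rmorphD coefD. Qed.

Definition mcons (e : nat) (k : 'X_{1..n}) : 'X_{1..n.+1} :=
  [multinom if unlift ord0 i is Some j then k j else e | i < n.+1].
Definition mtail (k : 'X_{1..n.+1}) : 'X_{1..n} := [multinom k (lift ord0 i) | i < n].

Lemma mcons_eq e k k' : (k' == mcons e k) = (k' ord0 == e) && (mtail k' == k).
Proof.
apply/eqP/andP => [->|[/eqP e0 /eqP kk]].
  split; first by rewrite mnmE unlift_none.
  by apply/eqP/mnmP => i; rewrite !mnmE liftK.
apply/mnmP => i; rewrite mnmE -kk; case: unliftP => [j ->|->]; last exact: e0.
by rewrite mnmE.
Qed.

Lemma polyX0_mon k : polyX0 'X_[k] = 'X^(k ord0) * ('X_[mtail k])%:P.
Proof.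
rewrite mpolyXE_id rmorph_prod big_ord_recl rmorphXn polyX0_var0; congr (_ * _).
rewrite mpolyXE_id rmorph_prod; apply: eq_bigr => i _ /=.
by rewrite rmorphXn polyX0_varS rmorphXn /= mnmE.
Qed.

Lemma mcoeff_slice e p k : (slice e p)@_k = p@_(mcons e k).
Proof.
elim/mpolyind: p => [|a k' p _ _ IH]; first by rewrite /slice rmorph0 coef0 !mcoeff0.
rewrite sliceD mcoeffD [RHS]mcoeffD; apply: (congr2 +%R); last exact: IH.
rewrite /slice polyX0Z polyX0_mon coefCM mcoeffZ mcoeffX mcons_eq mul_mpolyC mcoeffZ.
rewrite coefXnM; case: (ltngtP e (k' ord0)) => [_|lt|->]; rewrite ?mcoeff0 //=.
  by rewrite coefC gtn_eqF ?subn_gt0 // mcoeff0.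
by rewrite subnn coefC eqxx mcoeffX.
Qed.

Lemma trunc_ideal_slice m p :
  reflect (forall e, (e < q ^ m)%N -> slice e p \in @trunc_ideal F m n)
    (p \in @trunc_ideal F m n.+1).
Proof.
apply: (iffP (trunc_ideal_coef m p)) => [p0 e em|p0 k kq].
  apply/trunc_ideal_coef => k kq; rewrite mcoeff_slice p0 // => i.
  by rewrite mnmE; case: unlift.
have -> : k = mcons (k ord0) (mtail k) by apply/eqP; rewrite mcons_eq !eqxx.
rewrite -mcoeff_slice; apply: (trunc_ideal_coef m _ (p0 _ (kq ord0))) => i.
by rewrite mnmE.
Qed.

Lemma slice_X0n e e' p :
  slice e ('X_ord0 ^+ e' * p) = if (e < e')%N then 0 else slice (e - e') p.
Proof. by rewrite /slice rmorphM rmorphXn /= polyX0_var0 coefXnM. Qed.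

Lemma polyX0_shift (y : {mpoly F[n]}) : polyX0 (poly_omit ord0 y) = y%:P.
Proof.
pose t := [tuple ('X_(lift ord0 i) : {mpoly F[n.+1]}) | i < n].
apply: (mpoly_hom_eq (f := polyX0 \o comp_mpoly t) (g := polyC)) => [a|i] /=.
  by rewrite comp_mpolyC polyX0C.
by rewrite comp_mpolyXU -tnth_nth tnth_mktuple polyX0_varS.
Qed.

Lemma slice_shift e y : slice e (poly_omit ord0 y) = if e == 0%N then y else 0.
Proof. by rewrite /slice polyX0_shift coefC. Qed.

Lemma slice0 p : slice 0 p = ev p (fun i => if i is i'.+1 then genpt F n i' else 0).
Proof.
set v := fun _ => _; pose t := [tuple v i | i < n.+1].
rewrite evE /slice -horner_coef0 -/(horner_eval 0 _).
apply: (mpoly_hom_eq (f := horner_eval 0 \o polyX0) (g := comp_mpoly t)) => [a|i] /=.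
  by rewrite polyX0C comp_mpolyC /horner_eval hornerC.
rewrite comp_mpolyXU -tnth_nth tnth_mktuple /horner_eval.
case: (unliftP ord0 i) => [j ->|->]; last by rewrite polyX0_var0 hornerX.
by rewrite polyX0_varS hornerC /= genpt_ord.
Qed.

(** The substitution x_0 := t x_0 and x_{j+1} := s x_j + u_j x_0, with s acting on the
    other variables. *)
Definition upper_block (t : F) (u : 'rV[F]_n) (s : 'M[F]_n) : 'M[F]_n.+1 :=
  block_mx (t%:M : 'M_1) u 0 s.

Lemma upper_block00 t u s : upper_block t u s ord0 ord0 = t.
Proof.
have := @block_mxEul F 1 n 1 n t%:M u 0 s ord0 ord0; rewrite [RHS]mxE eqxx => E.
by rewrite -[RHS]E; congr (block_mx _ _ _ _ _ _); apply: val_inj.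
Qed.
Lemma upper_block0S t u s j : upper_block t u s ord0 (lift ord0 j) = u ord0 j.
Proof.
rewrite -(@block_mxEur F 1 n 1 n t%:M u 0 s ord0 j).
by congr (block_mx _ _ _ _ _ _); apply: val_inj.
Qed.
Lemma upper_blockS0 t u s i : upper_block t u s (lift ord0 i) ord0 = 0.
Proof.
have := @block_mxEdl F 1 n 1 n t%:M u 0 s i ord0; rewrite [RHS]mxE => E.
by rewrite -[RHS]E; congr (block_mx _ _ _ _ _ _); apply: val_inj.
Qed.
Lemma upper_blockSS t u s i j : upper_block t u s (lift ord0 i) (lift ord0 j) = s i j.
Proof.
rewrite -(@block_mxEdr F 1 n 1 n t%:M u 0 s i j).
by congr (block_mx _ _ _ _ _ _); apply: val_inj.
Qed.

Lemma upper_block_borel t u s : t != 0 -> s \in borel F n -> upper_block t u s \in borel F n.+1.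
Proof.
move=> t0; rewrite !inE => /andP[su /forallP st]; apply/andP; split.
  have dE : \det (upper_block t u s) = \det (t%:M : 'M_1) * \det s.
    exact: (@det_ublock F 1 n).
  by rewrite unitmxE dE det_scalar1 unitrM unitfE t0 -unitmxE.
apply/forallP => i; apply/forallP => j; apply/implyP => ji.
case: (unliftP ord0 i) ji => [i' ->|->] //; case: (unliftP ord0 j) => [j' ->|->] ji.
  by rewrite upper_blockSS; have /forallP/(_ j')/implyP := st i'; apply.
by rewrite upper_blockS0.
Qed.

Lemma mx_actX k (s : 'M[F]_k) j : mx_act s 'X_j = \sum_i s i j *: 'X_i.
Proof. by rewrite /mx_act comp_mpolyXU -tnth_nth tnth_mktuple. Qed.

(** Here tau x_j is the new value of x_{j+1}, as a polynomial in x_0; the slice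
    of index e then contributes to those of index E >= e. *)
Lemma slice_act t (u : 'rV[F]_n) s
    (tau : {rmorphism {mpoly F[n]} -> {poly {mpoly F[n]}}}) :
  (forall a, tau a%:MP = (a%:MP)%:P) ->
  (forall j, tau 'X_j = ((u ord0 j)%:MP)%:P * 'X + (mx_act s 'X_j)%:P) ->
  forall E (p : {mpoly F[n.+1]}), slice E (mx_act (upper_block t u s) p) =
    \sum_(e < E.+1) t ^+ e *: (tau (slice e p))`_(E - e).
Proof.
move=> tauC tauX E p; pose T : {poly {mpoly F[n]}} := (t%:MP)%:P * 'X.
(* Both sides are ring morphisms in p. *)
have polyX0E : polyX0 (mx_act (upper_block t u s) p) = (map_poly tau (polyX0 p)).[T].
  pose tt := [tuple \sum_i upper_block t u s i j *: ('X_i : {mpoly F[n.+1]}) | j < n.+1].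
  pose G1 : {rmorphism {mpoly F[n.+1]} -> {poly {mpoly F[n]}}} := polyX0 \o comp_mpoly tt.
  pose G2 : {rmorphism {mpoly F[n.+1]} -> {poly {mpoly F[n]}}} :=
    horner_eval T \o (map_poly tau \o polyX0).
  suff H : G1 =1 G2 by exact: (H p).
  apply: mpoly_hom_eq => [a|i].
    change (polyX0 (a%:MP \mPo tt) = horner_eval T (map_poly tau (polyX0 a%:MP))).
    rewrite comp_mpolyC !polyX0C map_polyC /horner_eval hornerC.
    by apply/esym/tauC.
  change (polyX0 ('X_i \mPo tt) = horner_eval T (map_poly tau (polyX0 'X_i))).
  rewrite comp_mpolyXU -tnth_nth tnth_mktuple big_ord_recl rmorphD polyX0Z polyX0_var0.
  rewrite rmorph_sum; case: (unliftP ord0 i) => [j ->|->]; last first.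
    rewrite upper_block00 polyX0_var0 /horner_eval map_polyX hornerX big1 ?addr0 // => k _ /=.
    by rewrite upper_blockS0 scale0r rmorph0.
  have -> : horner_eval T (map_poly tau (polyX0 'X_(lift ord0 j))) = tau 'X_j.
    by rewrite polyX0_varS map_polyC /horner_eval hornerC.
  rewrite tauX upper_block0S; congr (_ + _).
  rewrite mx_actX rmorph_sum; apply: eq_bigr => k _ /=.
  by rewrite polyX0Z polyX0_varS upper_blockSS -polyCM mul_mpolyC.
rewrite /slice polyX0E; pose N := maxn (size (polyX0 p)) E.+1.
rewrite (@horner_coef_wide _ N); last first.
  by rewrite (leq_trans (size_poly _ _)) // leq_maxl.
rewrite coef_sum [RHS](big_ord_widen N
  (fun e => t ^+ e *: (tau (slice e p))`_(E - e))) ?leq_maxr //.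
rewrite [RHS]big_mkcond; apply: eq_bigr => e _ /=.
have tE : (t%:MP)%:P ^+ e = ((t ^+ e)%:MP)%:P :> {poly {mpoly F[n]}} by rewrite !rmorphXn.
rewrite coef_map /= /T exprMn mulrCA tE coefCM coefMXn ltnS ltnNge.
by case: leqP => _; rewrite ?mulr0 // mul_mpolyC.
Qed.

End Slice.

(** * The slices of an invariant *)
Section Invariants.
Variable F : finFieldType.
Local Notation q := #|F|.

Local Notation TI m n := (@trunc_ideal F m n).

Definition borel_inv m n (f : {mpoly F[n]}) :=
  forall s, s \in borel F n -> mx_act s f - f \in TI m n.

Lemma mx_act1 n (p : {mpoly F[n]}) : mx_act 1%:M p = p.
Proof.
rewrite /mx_act -[RHS]comp_mpoly_id; congr (_ \mPo _); apply: eq_mktuple => j.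
rewrite (bigD1 j) //= mxE eqxx scale1r big1 ?addr0 // => i ij.
by rewrite mxE (negPf ij) scale0r.
Qed.

Lemma borel1 n : 1%:M \in borel F n.
Proof.
rewrite inE unitmx1; apply/forallP => i; apply/forallP => j; apply/implyP => ji.
by rewrite mxE -val_eqE /= gtn_eqF.
Qed.

(** This is the map tau of slice_act when no other variable meets x_0. *)
Definition act_polyC n (s : 'M[F]_n) : {rmorphism {mpoly F[n]} -> {poly {mpoly F[n]}}} :=
  polyC \o comp_mpoly [tuple \sum_i s i j *: 'X_i | j < n].

Lemma slice_act_diag n (t : F) s E (p : {mpoly F[n.+1]}) :
  slice E (mx_act (upper_block t 0 s) p) = t ^+ E *: mx_act s (slice E p).
Proof.
rewrite (@slice_act _ _ t 0 s (act_polyC s)) => [|a|j]; last 2 first.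
- by rewrite /act_polyC /= comp_mpolyC.
- by rewrite /act_polyC /= mxE !mpolyC0 mul0r add0r.
rewrite big_ord_recr /= big1 => [|e _]; last first.
  by rewrite /act_polyC /= coefC subn_eq0 leqNgt ltn_ord scaler0.
by rewrite add0r subnn coefC.
Qed.

Lemma borel_inv_slice m n (f : {mpoly F[n.+1]}) e : borel_inv m f -> (e < q ^ m)%N ->
  borel_inv m (slice e f).
Proof.
move=> fi em s sB; have := fi _ (upper_block_borel 0 (oner_neq0 F) sB).
move/trunc_ideal_slice/(_ e em).
by rewrite sliceB slice_act_diag // expr1n scale1r.
Qed.

Lemma trunc_ideal_unscale m n (a : F) (p : {mpoly F[n]}) :
  a != 0 -> a *: p \in TI m n -> p \in TI m n.
Proof.
move=> a0; have {2}-> : p = a^-1 *: (a *: p) by rewrite scalerA mulVf // scale1r.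
by rewrite -[a^-1 *: _]mul_mpolyC; apply: idealMr.
Qed.

(** Otherwise all nonzero elements of F would be roots of X ^ r - 1, where
    r < q - 1 is the remainder of e. *)
Lemma exists_power_neq1 e : ~~ (q.-1 %| e)%N -> exists2 t : F, t != 0 & t ^+ e != 1.
Proof.
move=> qe; set r := (e %% q.-1)%N; have q1 := qgt1 F.
have r0 : (0 < r)%N by rewrite lt0n.
have rq : (r < q.-1)%N by rewrite ltn_mod; lia.
have [/existsP[t /andP[t0 te]]|/existsPn noex] :=
  boolP [exists t : F, (t != 0) && (t ^+ e != 1)]; first by exists t.
exfalso; pose P : {poly F} := 'X^r - 1.
have P0 : P != 0 by rewrite -size_poly_eq0 size_XnsubC.
have tq (t : F) : t != 0 -> t ^+ q.-1 = 1.
  move=> t0; apply: (mulfI t0); rewrite -exprS prednK ?(ltnW q1) // mulr1.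
  exact: expf_card.
have := max_poly_roots (rs := [seq t <- enum F | t != 0]) P0.
have -> : all (root P) [seq t <- enum F | t != 0].
  apply/allP => t; rewrite mem_filter => /andP[t0 _].
  have := noex t; rewrite t0 /= negbK {1}(divn_eq e q.-1) exprD mulnC exprM tq //.
  by rewrite expr1n mul1r => /eqP tr; rewrite rootE !hornerE tr subrr.
rewrite filter_uniq ?enum_uniq // => /(_ isT isT); rewrite size_XnsubC // ltnS.
rewrite size_filter => H.
have cE : count (fun t : F => t != 0) (enum F) = q.-1.
  have := count_predC (pred1 (0 : F)) (enum F).
  by rewrite -cardE count_uniq_mem ?enum_uniq // mem_enum /= => <-.
by move: H; rewrite cE; lia.
Qed.

(** Scaling x_0 by t multiplies the slice of index e by t ^ e. *)
Lemma slice_torus m n (f : {mpoly F[n.+1]}) e : borel_inv m f -> (e < q ^ m)%N ->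
  ~~ (q.-1 %| e)%N -> slice e f \in TI m n.
Proof.
move=> fi em /exists_power_neq1[t t0 te].
have := fi _ (upper_block_borel 0 t0 (borel1 n)); move/trunc_ideal_slice/(_ e em).
rewrite sliceB slice_act_diag // mx_act1 -[X in _ - X]scale1r -scalerBl.
by apply: trunc_ideal_unscale; rewrite subr_eq0.
Qed.

Section ShiftVariable.
Variables (n : nat) (j : 'I_n).

Definition shift_var_gen (i : 'I_n) : {poly {mpoly F[n]}} :=
  if i == j then ('X_j)%:P + 'X else ('X_i)%:P.

(** Taylor expansion in the variable x_j: the coefficient of index i of the image of p
    is the i-th Hasse derivative of p with respect to x_j. *)
Definition shift_var : {rmorphism {mpoly F[n]} -> {poly {mpoly F[n]}}} :=
  mmap (polyC \o @mpolyC n F) shift_var_gen.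

Lemma shift_varC a : shift_var a%:MP = (a%:MP)%:P.
Proof. by rewrite /shift_var /= mmapC. Qed.
Lemma shift_varX i : shift_var 'X_i = shift_var_gen i.
Proof. by rewrite /shift_var /= mmapX mmap1U. Qed.
Lemma shift_varZ a p : shift_var (a *: p) = (a%:MP)%:P * shift_var p.
Proof. by rewrite -mul_mpolyC rmorphM shift_varC. Qed.

Lemma coef_shift_var_mon (k : 'X_{1..n}) i : (shift_var 'X_[k])`_i =
  (if (i <= k j)%N then 'X_[k - U_(j) *+ i] else 0) *+ 'C(k j, i).
Proof.
have -> : shift_var 'X_[k] = (('X_j)%:P + 'X) ^+ k j * ('X_[k - U_(j) *+ k j])%:P.
  rewrite mpolyXE_id rmorph_prod (bigD1 j) //= rmorphXn shift_varX /shift_var_gen eqxx.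
  congr (_ * _); rewrite [in RHS]mpolyXE_id rmorph_prod [RHS](bigD1 j) //=.
  rewrite mnmBE mulmnE mnm1E eqxx mul1n subnn expr0 polyC1 mul1r.
  apply: eq_bigr => l lj; rewrite rmorphXn shift_varX /shift_var_gen (negPf lj) [RHS]rmorphXn.
  by rewrite mnmBE mulmnE mnm1E eq_sym (negPf lj) mul0n subn0.
rewrite coefMC exprDn coef_sum.
have tE l : ((('X_j)%:P ^+ (k j - l) * 'X^l) *+ 'C(k j, l) : {poly {mpoly F[n]}})`_i =
   (if i == l then 'X_j ^+ (k j - l) else 0) *+ 'C(k j, l).
  by rewrite coefMn -polyC_exp coefCM coefXn; case: eqP; rewrite ?mulr1 ?mulr0.
case: leqP => ik; last first.
  rewrite big1 ?mul0r ?mul0rn // => l _; rewrite tE gtn_eqF ?mul0rn //.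
  by apply: leq_ltn_trans ik; rewrite -ltnS.
rewrite (bigD1 (Ordinal (ik : i < (k j).+1)%N)) //= big1 => [|l li]; last first.
  by rewrite tE eq_sym (negPf (_ : l != i :> nat)) ?mul0rn.
rewrite tE eqxx addr0 mulrnAl; congr (_ *+ _).
rewrite mpolyXn -mpolyXD; congr 'X_[_]; apply/mnmP => l.
rewrite mnmDE !mulmnE !mnmBE !mulmnE mnm1E; case: eqP => [<-|_] /=; lia.
Qed.

Lemma mcoeff_shift_var (p : {mpoly F[n]}) i k :
  ((shift_var p)`_i)@_k = p@_(k + U_(j) *+ i) *+ 'C(k j + i, i).
Proof.
elim/mpolyind: p => [|a k' p _ _ IH]; first by rewrite rmorph0 coef0 !mcoeff0 mul0rn.
rewrite rmorphD coefD mcoeffD [in RHS]mcoeffD mulrnDl; apply: (congr2 +%R); last exact: IH.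
rewrite shift_varZ coefCM coef_shift_var_mon mul_mpolyC !mcoeffZ mcoeffX mcoeffMn mulrnAr.
case: leqP => ik; last first.
  rewrite mcoeff0 mulr0 mul0rn; case: eqP => [kE|_]; last by rewrite mulr0 mul0rn.
  by move: ik; rewrite kE mnmDE mulmnE mnm1E eqxx mul1n ltnNge leq_addl.
rewrite mcoeffX; have -> : ((k' - U_(j) *+ i)%MM == k) = (k' == (k + U_(j) *+ i)%MM).
  have Uk : (U_(j) *+ i <= k')%MM.
    by apply/mnm_lepP => l; rewrite mulmnE mnm1E; case: eqP => [<-|_]; rewrite ?mul1n.
  by apply/eqP/eqP => [<-|->]; rewrite ?submK ?addmK.
case: eqP => [->|_]; last by rewrite !mulr0 !mul0rn.
by rewrite mnmDE mulmnE mnm1E eqxx mul1n.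
Qed.

Lemma shift_var_coef0 p : (shift_var p)`_0 = p.
Proof.
apply/mpolyP => k; rewrite mcoeff_shift_var bin0; congr (_@_ _).
by apply/mnmP => l; rewrite mnmDE mulmnE muln0 addn0.
Qed.

(** The power of x_j + X of exponent q ^ m has no terms of degree between 1 and
    q ^ m - 1 in X. *)
Lemma shift_var_ideal m i p : p \in TI m n -> (i < q ^ m)%N -> (shift_var p)`_i \in TI m n.
Proof.
move=> /asboolP[g ->] im; rewrite rmorph_sum coef_sum; apply: rpred_sum => l _.
rewrite rmorphM rmorphXn shift_varX /shift_var_gen; case: eqP => [->|_]; last first.
  by rewrite -polyC_exp coefMC; apply/idealMr/trunc_idealX.
rewrite (frobD_gen (polyC \o @mpolyC n F)).
rewrite mulrDr coefD coefMXn im addr0 -polyC_exp coefMC.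
exact/idealMr/trunc_idealX.
Qed.

End ShiftVariable.

(** A case of Lucas's congruence: for k = q s + r, (1 + X) ^ k is
    (1 + X ^ q) ^ s (1 + X) ^ r. *)
Lemma bin_modq k : (0 < k %% q)%N -> 'C(k, k %% q)%:R = 1 :> F.
Proof.
set r := (k %% q)%N => _; have rq : (r < q)%N by rewrite ltn_mod qgt0.
have coefE l : (('X + 1) ^+ l : {poly F})`_r = 'C(l, r)%:R.
  rewrite exprD1n coef_sum; case: (leqP r l) => rl; last first.
    rewrite bin_small // big1 // => i _; rewrite coefMn coefXn gtn_eqF ?mul0rn //.
    by apply: leq_ltn_trans rl; rewrite -ltnS.
  rewrite (bigD1 (Ordinal (rl : r < l.+1)%N)) //= coefMn coefXn eqxx big1 ?addr0 // => i ir.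
  by rewrite coefMn coefXn eq_sym (negPf (_ : i != r :> nat)) ?mul0rn.
have frobX : ('X + 1) ^+ q = 'X^q + 1 :> {poly F}.
  by have := frobD_gen (@polyC F) 'X 1 1; rewrite expn1 expr1n.
rewrite -coefE {1}(divn_eq k q) -/r exprD mulnC exprM frobX.
rewrite -[X in X * _](subrK 1) -[X in _ - X + _](expr1n _ (k %/ q)) subrXX.
rewrite addrK mulrDl mul1r -mulrA coefD coefXnM rq add0r coefE binn.
by [].
Qed.

(** Let E = k (q - 1) be the index of the lowest slice. In the invariance of f under
    the substitution x_{j+1} := x_{j+1} + x_0, compare the slices of index E + i. The
    slices of index strictly between E and E + q - 1 vanish by torus invariance, so the
    only new term comes from the i-th Hasse derivative of the lowest slice. *)
Lemma slice_shift_var m n (f : {mpoly F[n.+1]}) k j i : borel_inv m f ->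
  (k * q.-1 + q.-1 < q ^ m)%N ->
  (forall e, (e < k * q.-1)%N -> slice e f \in TI m n) -> (0 < i < q)%N ->
  (shift_var j (slice (k * q.-1) f))`_i \in TI m n.
Proof.
move=> fi kq f0 /andP[i0 iq]; set E := (k * q.-1)%N.
have Ei : (E + i < q ^ m)%N by rewrite /E; lia.
pose u : 'rV[F]_n := \row_l (l == j)%:R.
have := fi _ (upper_block_borel u (oner_neq0 F) (borel1 n)).
move/trunc_ideal_slice/(_ _ Ei); rewrite sliceB.
rewrite (@slice_act _ _ 1 u 1%:M (shift_var j)); last 2 first.
- exact: shift_varC.
- move=> l; rewrite shift_varX /shift_var_gen mxE mx_act1; case: eqP => [->|_].
    by rewrite mpolyC1 mul1r addrC.
  by rewrite !mpolyC0 mul0r add0r.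
rewrite big_ord_recr [nat_of_ord ord_max]/=.
rewrite [X in _ + X - _](_ : _ = slice (E + i) f); last first.
  by rewrite expr1n scale1r subnn shift_var_coef0.
rewrite addrK.
have Elt : (E < E + i)%N by rewrite -addn1 leq_add2l.
rewrite (bigD1 (Ordinal Elt)) //= expr1n scale1r addKn => H.
rewrite -[X in X \in _](addrK (\sum_(e < E + i | e != Ordinal Elt)
  1 ^+ e *: (shift_var j (slice e f))`_(E + i - e))).
apply: rpredB => //; apply: rpred_sum => e; rewrite -val_eqE /= => eE.
have eEi := ltn_ord e.
rewrite expr1n scale1r; apply: shift_var_ideal; last by lia.
case: (ltngtP e E) eE => // [eE|Ee] _; first exact: f0.
apply: slice_torus => //; first by lia.
have -> : (e = k * q.-1 + (e - E) :> nat)%N by rewrite -/E; lia.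
rewrite dvdn_addr ?dvdn_mull // gtnNdvd //; lia.
Qed.

End Invariants.

(** * The lowest slice is a q-th power *)
Section Basis.
Variable F : finFieldType.
Local Notation q := #|F|.
Local Notation TI m n := (@trunc_ideal F m n).
Local Notation Q m n := (trunc_ring F m n).
Local Notation Inv m n := (borel_invariants F m n).

Lemma mcoeff_frobq n (p : {mpoly F[n]}) k : (p ^+ q)@_(k *+ q) = p@_k.
Proof.
elim/mpolyind: p => [|a k' p _ _ IH].
  by rewrite expr0n eqn0Ngt qgt0 !mcoeff0.
rewrite frobq_linear mcoeffD [in RHS]mcoeffD; apply: (congr2 +%R); last exact: IH.
rewrite !mcoeffZ mpolyXn !mcoeffX; congr (_ * (_ : bool)%:R).
apply/eqP/eqP => [/mnmP kk|-> //]; apply/mnmP => i; have := kk i.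
by rewrite !mulmnE => /eqP; rewrite eqn_pmul2r ?qgt0 // => /eqP.
Qed.

Lemma mcoeff_frobq0 n (p : {mpoly F[n]}) (k : 'X_{1..n}) j :
  ~~ (q %| k j)%N -> (p ^+ q)@_k = 0.
Proof.
move=> kj; elim/mpolyind: p => [|a k' p _ _ IH].
  by rewrite expr0n eqn0Ngt qgt0 !mcoeff0.
rewrite frobq_linear mcoeffD mcoeffZ mpolyXn mcoeffX; case: eqP => [kE|_].
  by move: kj; rewrite -kE mulmnE dvdn_mull.
by rewrite mulr0 add0r.
Qed.

Lemma frobq_ideal m n (p : {mpoly F[n]}) : (p ^+ q \in TI m.+1 n) = (p \in TI m n).
Proof.
apply/idP/idP => [/trunc_ideal_coef p0|/asboolP[g ->]]; last first.
  rewrite frobq_sum; apply: rpred_sum => i _.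
  by rewrite exprMn -exprM -expnSr; apply/idealMr/trunc_idealX.
apply/trunc_ideal_coef => k kq; rewrite -mcoeff_frobq; apply: p0 => i.
by rewrite mulmnE expnSr ltn_pmul2r ?qgt0.
Qed.

Lemma mx_act_frobq n (s : 'M[F]_n) p : mx_act s (p ^+ q) = mx_act s p ^+ q.
Proof. exact: rmorphXn. Qed.

(** If the Hasse derivatives of order 1, ..., q - 1 of g vanish, a monomial of g whose
    exponent k_j has remainder r > 0 modulo q is excluded by the derivative of order r,
    by bin_modq. So g is a q-th power y ^ q modulo the ideal. As raising to the power q
    commutes with F-linear substitutions and is injective on the truncated rings, y is
    invariant because g is. *)
Lemma lowest_slice_frobq m n (g : {mpoly F[n]}) : borel_inv m.+1 g ->
  (forall j i, (0 < i < q)%N -> (shift_var F j g)`_i \in TI m.+1 n) ->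
  exists2 y, borel_inv m y & g - y ^+ q \in TI m.+1 n.
Proof.
move=> gi gt.
have g0 (k : 'X_{1..n}) j : (forall i, k i < q ^ m.+1)%N -> ~~ (q %| k j)%N -> g@_k = 0.
  move=> kq kj; set r := (k j %% q)%N; have r0 : (0 < r)%N by rewrite lt0n.
  have rq : (r < q)%N by rewrite ltn_mod qgt0.
  have rk : (r <= k j)%N by apply: leq_mod.
  have := gt j r; rewrite r0 rq => /(_ isT)/trunc_ideal_coef/(_ (k - U_(j) *+ r)%MM) H.
  have kq' i : ((k - U_(j) *+ r)%MM i < q ^ m.+1)%N.
    by rewrite mnmBE; apply: leq_ltn_trans (leq_subr _ _) (kq i).
  have Uk : (U_(j) *+ r <= k)%MM.
    by apply/mnm_lepP => l; rewrite mulmnE mnm1E; case: eqP => [<-|_]; rewrite ?mul1n.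
  have := H kq'; rewrite mcoeff_shift_var submK // mnmBE mulmnE mnm1E eqxx mul1n subnK //.
  by rewrite -[_ *+ _]mulr_natr bin_modq // mulr1.
pose y : {mpoly F[n]} := \sum_(e : {ffun 'I_n -> 'I_(q ^ m)}) g@_(tmon e *+ q) *: 'X_[tmon e].
have yE (e : {ffun 'I_n -> 'I_(q ^ m)}) : y@_(tmon e) = g@_(tmon e *+ q).
  rewrite /y raddf_sum /= (bigD1 e) //= mcoeffZ mcoeffX eqxx mulr1 big1 ?addr0 // => e' ee.
  by rewrite mcoeffZ mcoeffX (inj_eq (@tmon_inj F m n)) (negPf ee) mulr0.
have gy : g - y ^+ q \in TI m.+1 n.
  apply/trunc_ideal_coef => k kq; rewrite mcoeffB; apply/eqP; rewrite subr_eq0; apply/eqP.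
  have [/forallP kd|] := boolP [forall j, q %| k j]%N; last first.
    by rewrite negb_forall => /existsP[j kj]; rewrite (g0 k j) // (mcoeff_frobq0 _ kj).
  have ke j : (k j %/ q < q ^ m)%N by rewrite ltn_divLR ?qgt0 // -expnSr.
  have -> : k = (tmon [ffun j => Ordinal (ke j)] *+ q)%MM.
    by apply/mnmP => j; rewrite mulmnE mnmE ffunE /= divnK.
  by rewrite mcoeff_frobq yE.
exists y => // s sB; rewrite -frobq_ideal.
have -> : (mx_act s y - y) ^+ q = mx_act s (y ^+ q) - y ^+ q.
  by have := frobB (mx_act s y) y 1; rewrite expn1 mx_act_frobq.
have -> : mx_act s (y ^+ q) - y ^+ q =
    (mx_act s g - g) + (g - y ^+ q) - mx_act s (g - y ^+ q).
  by rewrite /mx_act raddfB /=; ring.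
by apply: rpredB; [apply: rpredD => //; apply: gi | apply: mx_act_ideal].
Qed.

(** ** Linear maps between truncated rings *)
Section Induced.
Variables (m n m' n' : nat) (g : {mpoly F[n]} -> {mpoly F[n']}).
Hypothesis glin : linear g.
Hypothesis gI : forall p, p \in TI m n -> g p \in TI m' n'.

Definition induced (x : Q m n) : Q m' n' := \pi_(Q m' n') (g (repr x)).

Let gB p r : g (p - r) = g p - g r.
Proof. by rewrite [p - r]addrC -scaleN1r glin scaleN1r addrC. Qed.

Lemma induced_pi p : induced (\pi_(Q m n) p) = \pi_(Q m' n') (g p).
Proof.
by apply/pi_trunc_eq; rewrite -gB; apply/gI/pi_trunc_eq; rewrite reprK.
Qed.

Lemma induced_linear : linear induced.
Proof.
move=> a x y; rewrite -[x]reprK -[y]reprK -pi_truncZ -rmorphD !induced_pi.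
by rewrite glin rmorphD /= pi_truncZ.
Qed.

HB.instance Definition _ := GRing.isLinear.Build F (Q m n) (Q m' n') _ induced induced_linear.

Lemma induced_hom : exists phi : 'Hom(Q m n, Q m' n'),
  forall p, phi (\pi_(Q m n) p) = \pi_(Q m' n') (g p).
Proof. by exists (linfun induced) => p; rewrite lfunE /= induced_pi. Qed.

End Induced.

Lemma borel_invP m n (f : {mpoly F[n]}) :
  reflect (borel_inv m f) (\pi_(Q m n) f \in Inv m n).
Proof.
apply: (iffP (borel_invariantsP _)) => fi s sB; have := fi s sB.
  by rewrite trunc_act_pi => /pi_trunc_eq.
by move=> ?; rewrite trunc_act_pi; apply/pi_trunc_eq.
Qed.

Lemma pi_eq0 m n (f : {mpoly F[n]}) : (\pi_(Q m n) f == 0) = (f \in TI m n).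
Proof.
apply/eqP/idP => [f0|fI].
  by rewrite -[f]subr0; apply/pi_trunc_eq; rewrite f0 rmorph0.
by rewrite -(rmorph0 (\pi_(Q m n))); apply/pi_trunc_eq; rewrite subr0.
Qed.

End Basis.

(** * Extending bases along a filtration *)
(** A basis of a kernel, preceded by preimages of a basis of the image. *)
Lemma basis_ext (K : fieldType) (V V2 : vectType K) (phi : 'Hom(V, V2))
    (W : {vspace V}) (W2 : {vspace V2}) (X X' : seq V) :
  basis_of (W :&: lker phi) X' -> {subset X <= W} ->
  basis_of W2 (map phi X) -> (phi @: W <= W2)%VS -> basis_of W (X ++ X').
Proof.
move=> bX' XW bX WW2.
have sXW : (<<X>> <= W)%VS by apply/span_subvP.
have imW : (phi @: W)%VS = W2.
  apply/eqP; rewrite eqEsubv WW2 -(span_basis bX) -limg_span.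
  exact: limgS.
rewrite basisEdim; apply/andP; split.
  apply/subvP => w wW; have : phi w \in (phi @: <<X>>)%VS.
    by rewrite limg_span (span_basis bX) (subvP WW2) // memv_img.
  case/memv_imgP => u uX wu; rewrite -(subrK u w) addrC span_cat memv_add //.
  rewrite (span_basis bX') memv_cap memv_ker linearB /= wu subrr eqxx andbT.
  by rewrite memvB // (subvP sXW).
have szE (V' : vectType K) (U : {vspace V'}) Y : basis_of U Y -> size Y = \dim U.
  by move=> bY; rewrite -(span_basis bY); apply/esym/eqP/(basis_free bY).
by rewrite size_cat -(limg_ker_dim phi W) imW addnC -(szE _ _ _ bX) size_map (szE _ _ _ bX').
Qed.

(** * The inductive step *)
Section Step.
Variable F : finFieldType.
Local Notation q := #|F|.
Local Notation TI m n := (@trunc_ideal F m n).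
Local Notation Q m n := (trunc_ring F m n).
Local Notation Inv m n := (borel_invariants F m n).
Local Notation "p %:F" := (FracField.tofrac p).

Lemma qbracketK m : (qbracket q m * q.-1)%N = (q ^ m).-1.
Proof. by rewrite divnK // predn_exp dvdn_mulr. Qed.

(** This is delta_{1;m}(y). *)
Definition top_el m n (y : {mpoly F[n]}) : {mpoly F[n.+1]} :=
  'X_ord0 ^+ (q ^ m).-1 * poly_omit ord0 y.
(** This is the product of the power a of D_1 with z. *)
Definition low_el n a (z : {mpoly F[n.+1]}) := 'X_ord0 ^+ (a * q.-1) * z.

Lemma slice_top_el m n e (y : {mpoly F[n]}) :
  slice e (top_el m y) = if e == (q ^ m).-1 then y else 0.
Proof.
rewrite /top_el slice_X0n slice_shift subn_eq0; case: ltngtP => //.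
Qed.

(** The invariants are filtered by the vanishing of the slices of index i (q - 1) for
    i < k. For k < [m+1]_q, the slice of index k (q - 1) maps the k-th step to the q-th
    powers of invariants of the smaller ring, its kernel is the next step, and the
    products of the k-th power of D_1 with the lifts z.1 are mapped to a basis. On the
    last step only the slice of index q ^ (m+1) - 1 survives, and it is an arbitrary
    invariant. *)
Lemma basis_step m n (S1 : seq {mpoly F[n]}) (S2 : seq ({mpoly F[n.+1]} * {mpoly F[n]})) :
  basis_of (Inv m.+1 n) [seq \pi_(Q m.+1 n) y | y <- S1] ->
  basis_of (Inv m n) [seq \pi_(Q m n) z.2 | z <- S2] ->
  (forall z, z \in S2 -> slice 0 z.1 = z.2 ^+ q) ->
  (forall y, y \in S1 -> borel_inv m.+1 (top_el m.+1 y)) ->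
  (forall a z, (a < qbracket q m.+1)%N -> z \in S2 -> borel_inv m.+1 (low_el a z.1)) ->
  basis_of (Inv m.+1 n.+1)
    ([seq \pi_(Q m.+1 n.+1) (top_el m.+1 y) | y <- S1] ++
     [seq \pi_(Q m.+1 n.+1) (low_el a z.1) | a <- iota 0 (qbracket q m.+1), z <- S2]).
Proof.
set N := qbracket q m.+1 => B1 B2 red2 inv1 inv2.
have NE : (N * q.-1 = (q ^ m.+1).-1)%N := qbracketK m.+1.
have q1 := qgt1 F; have qm := qe_gt0 F m.+1.
have ltN k : (k <= N)%N -> (k * q.-1 < q ^ m.+1)%N.
  by move=> kN; rewrite -(prednK qm) ltnS -NE leq_mul2r kN orbT.
have /boolp.choice[phi phiE] : forall e, exists phi : 'Hom(Q m.+1 n.+1, Q m.+1 n),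
    forall p, (e < q ^ m.+1)%N -> phi (\pi_(Q m.+1 n.+1) p) = \pi_(Q m.+1 n) (slice e p).
  move=> e.
  case: (ltnP e (q ^ m.+1)) => em; last by exists 0.
  have [||phi phiE] := @induced_hom F m.+1 n.+1 m.+1 n (slice e).
  - exact: slice_linear.
  - by move=> p /trunc_ideal_slice; apply.
  by exists phi => p _.
have [theta thetaE] : exists theta : 'Hom(Q m.+1 n, Q m.+1 n.+1),
    forall p, theta (\pi_(Q m.+1 n) p) = \pi_(Q m.+1 n.+1) (top_el m.+1 p).
  apply: induced_hom => [a p r|p pI].
    by rewrite /top_el /poly_omit comp_mpolyD comp_mpolyZ mulrDr scalerAr.
  apply/trunc_ideal_slice => e em; rewrite slice_top_el.
  by case: eqP; rewrite ?rpred0.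
have [frob frobE] : exists frob : 'Hom(Q m n, Q m.+1 n),
    forall p, frob (\pi_(Q m n) p) = \pi_(Q m.+1 n) (p ^+ q).
  apply: induced_hom => [a p r|p]; first exact: frobq_linear.
  by rewrite frobq_ideal.
(* W k is the k-th step of the filtration. *)
pose W k : {vspace Q m.+1 n.+1} :=
  (Inv m.+1 n.+1 :&: \bigcap_(i < k) lker (phi (i * q.-1)%N))%VS.
have WP k f : (k <= N)%N -> reflect (borel_inv m.+1 f /\
    forall i, (i < k)%N -> slice (i * q.-1) f \in TI m.+1 n) (\pi_(Q m.+1 n.+1) f \in W k).
  move=> kN; rewrite memv_cap; apply: (iffP andP) => -[/borel_invP fi f0]; split=> //.
    move=> i ik; move: f0; rewrite memvE => /subv_bigcapP/(_ (Ordinal ik) isT).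
    by rewrite -memvE memv_ker phiE ?pi_eq0 //; apply/ltN/ltnW/(leq_trans ik).
  rewrite memvE; apply/subv_bigcapP => i _; rewrite -memvE memv_ker phiE ?pi_eq0.
    exact: f0.
  by apply/ltN/ltnW/(leq_trans (ltn_ord i)).
have WS k : W k.+1 = (W k :&: lker (phi (k * q.-1)%N))%VS.
  by rewrite /W big_ord_recr /= capvA.
have top_basis : basis_of (W N) [seq \pi_(Q m.+1 n.+1) (top_el m.+1 y) | y <- S1].
  have -> : W N = (theta @: Inv m.+1 n)%VS.
    apply/eqP; rewrite eqEsubv; apply/andP; split.
      apply/subvP => w; rewrite -[w]reprK; move: (repr w) => f /(WP _ _ (leqnn N))[fi f0].
      have hi : borel_inv m.+1 (slice (q ^ m.+1).-1 f).
        by apply: borel_inv_slice; rewrite ?prednK.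
      have -> : \pi_(Q m.+1 n.+1) f = theta (\pi_(Q m.+1 n) (slice (q ^ m.+1).-1 f)).
        rewrite thetaE; apply/pi_trunc_eq/trunc_ideal_slice => e em.
        rewrite sliceB slice_top_el; case: eqP => [->|/eqP ne]; first by rewrite subrr rpred0.
        rewrite subr0; have [/dvdnP[i eE]|qe] := boolP (q.-1 %| e)%N; last exact: slice_torus.
        rewrite eE; apply: f0; rewrite ltnNge; apply: contra ne => Ni.
        rewrite eqn_leq -ltnS prednK // em -NE eE leq_mul2r Ni orbT //.
      by apply/memv_img/borel_invP.
    rewrite -(span_basis B1) limg_span; apply/span_subvP => w.
    rewrite -map_comp => /mapP[y yS ->] /=; rewrite thetaE; apply/(WP _ _ (leqnn N)).
    split=> [|i iN]; first exact: inv1.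
    rewrite slice_top_el -NE eqn_pmul2r; last by lia.
    by rewrite ltn_eqF // rpred0.
  rewrite (eq_map (g := theta \o \pi_(Q m.+1 n))) => [|y /=]; last by rewrite thetaE.
  rewrite map_comp; apply: limg_basis_of B1.
  apply/eqP; rewrite -subv0; apply/subvP => w; rewrite memv_cap memv_ker => /andP[_ /eqP w0].
  move: w0; rewrite -[w]reprK thetaE => /eqP; rewrite pi_eq0.
  move/trunc_ideal_slice/(_ (q ^ m.+1).-1).
  rewrite prednK // slice_top_el eqxx => /(_ (leqnn _)).
  by rewrite -(pi_eq0 m.+1) => /eqP ->; apply: mem0v.
have frob_basis : basis_of (frob @: Inv m n)%VS [seq frob (\pi_(Q m n) z.2) | z <- S2].
  have -> : [seq frob (\pi_(Q m n) z.2) | z <- S2] =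
    map frob [seq \pi_(Q m n) z.2 | z <- S2] by rewrite -map_comp.
  apply: limg_basis_of B2.
  apply/eqP; rewrite -subv0; apply/subvP => w; rewrite memv_cap memv_ker => /andP[_ /eqP w0].
  move: w0; rewrite -[w]reprK frobE => /eqP; rewrite pi_eq0 frobq_ideal.
  by rewrite -(pi_eq0 m) => /eqP ->; apply: mem0v.
suff H k : (k <= N)%N -> basis_of (W (N - k)%N)
    ([seq \pi_(Q m.+1 n.+1) (top_el m.+1 y) | y <- S1] ++
     [seq \pi_(Q m.+1 n.+1) (low_el a z.1) | a <- iota (N - k) k, z <- S2]).
  have := H N (leqnn N); rewrite subnn /W big_ord0 capvf.
  by [].
elim: k => [|k IH] kN; first by rewrite subn0 /= cats0.
set j := (N - k.+1)%N; have jk : (N - k = j.+1)%N by rewrite /j; lia.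
have jN : (j < N)%N by rewrite /j; lia.
have jN' := ltnW jN; have {IH} := IH (ltnW kN); rewrite jk WS => IH.
set A := [seq _ | y <- S1] in IH *; set R := [seq _ | a <- iota j.+1 k, z <- S2] in IH.
pose X := [seq \pi_(Q m.+1 n.+1) (low_el j z.1) | z <- S2].
have perm_el : perm_eq (A ++ (X ++ R)) (X ++ (A ++ R)) by exact/permPl/perm_catCA.
rewrite -[X in basis_of _ X]/(A ++ (X ++ R)) (perm_basis _ perm_el).
have lowE z : phi (j * q.-1)%N (\pi_(Q m.+1 n.+1) (low_el j z)) = \pi_(Q m.+1 n) (slice 0 z).
  by rewrite phiE ?ltN // /low_el slice_X0n ltnn subnn.
apply: (basis_ext (W2 := (frob @: Inv m n)%VS)) IH _ _ _.
- move=> w /mapP[z zS ->]; apply/(WP _ _ jN'); split=> [|i ij]; first exact: inv2.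
  by rewrite /low_el slice_X0n ltn_pmul2r ?ij ?rpred0 //; lia.
- rewrite -map_comp (eq_in_map _ (fun z => frob (\pi_(Q m n) z.2)) _).1 //.
  by move=> z zS /=; rewrite lowE frobE red2.
- apply/subvP => _ /memv_imgP[w wW ->]; move: wW; rewrite -[w]reprK.
  move: (repr w) => f /(WP _ _ jN')[fi f0]; rewrite phiE ?ltN //.
  have [y yi /pi_trunc_eq ->] :
      exists2 y, borel_inv m y & slice (j * q.-1) f - y ^+ q \in TI m.+1 n.
    apply: lowest_slice_frobq => [|l i il]; first exact: borel_inv_slice (ltN _ jN').
    apply: slice_shift_var => // [|e ej].
      have := ltN _ jN; rewrite mulSn addnC; lia.
    have em : (e < q ^ m.+1)%N by apply: ltn_trans ej (ltN _ jN').
    have [/dvdnP[i' eE]|qe] := boolP (q.-1 %| e)%N; last exact: slice_torus.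
    by rewrite eE; apply: f0; move: ej; rewrite eE ltn_pmul2r //; lia.
  by rewrite -frobE; apply/memv_img/borel_invP.
Qed.

End Step.

(** * The sets B_m(n) *)
Section Final.
Variable F : finFieldType.
Local Notation q := #|F|.
Local Notation Q m n := (trunc_ring F m n).
Local Notation Inv m n := (borel_invariants F m n).
Local Notation "p %:F" := (FracField.tofrac p).

Lemma Y_poly m IJ n : n = (size IJ + sumn (unzip1 IJ))%N ->
  exists2 f, Y F m IJ n = f%:F & borel_inv m f.
Proof.
move=> nE; have [f [_ [fE _ [_ Tf Qf] _ _]]] := @Yrec_poly F m IJ 0 n nE.
by exists f => //; apply/borel_invP/borel_invariants_pi.
Qed.

Lemma Y_delta1 m IJ n (f : {mpoly F[n]}) : (0 < size IJ)%N -> Y F m IJ n = f%:F ->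
  Y F m (delta1_idx IJ) n.+1 = (top_el m f)%:F.
Proof.
case: IJ => // -[i j] IJ _ fE; rewrite /delta1_idx -delta1_Y fE delta1E.
by rewrite omit_poly /top_el rmorphM rmorphXn.
Qed.

Lemma Y_D1 m IJ n a (f : {mpoly F[n.+1]}) : Yrec F m 2 IJ n.+1 = f%:F ->
  Y F m (D1_Phi_idx a IJ) n.+1 = (low_el a f)%:F.
Proof.
move=> fE; transitivity (Dfam F 1 n.+1 ^+ a * Yrec F m 2 IJ n.+1); first by [].
by rewrite D1E fE /low_el rmorphM rmorphXn /= -exprM mulnC.
Qed.

(** A truncated ring of dimension 1 consists of the constants. *)
Lemma basis_one m n : #|{ffun 'I_n -> 'I_(q ^ m)}| = 1%N ->
  basis_of (Inv m n) [:: \pi_(Q m n) 1].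
Proof.
move=> card1; have pi1 : \pi_(Q m n) 1 != 0 by rewrite rmorph1 oner_eq0.
rewrite basisEfree seq1_free pi1 span_seq1 /= -memvE; apply/andP; split.
  by apply/borel_invP => s _; rewrite /mx_act rmorph1 subrr rpred0.
apply: leq_trans (dimvS (subvf _)) _; rewrite dimvf -card1.
exact: leqnn.
Qed.

Lemma Y0_one n : Y F 0 [:: (n, 0)]%N n.+1 = 1%:F.
Proof.
elim: n => [|n IH]; first by rewrite /Y /= mulr1 tofrac1.
rewrite -[[:: _]]/(delta1_idx [:: (n, 0)]%N) (Y_delta1 _ IH) //.
by rewrite /top_el /poly_omit rmorph1 mulr1.
Qed.

Lemma basis_calB n m : basis_of (Inv m n.+1) [seq \pi_(Q m n.+1) p | p <- calB F m n.+1].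
Proof.
elim: n m => [|n IH] [|m].
- rewrite /calB /= Y0_one polyofK; apply: basis_one.
  by rewrite card_ffun !card_ord exp1n.
- have low a : polyof (Y F m.+1 [:: (0%N, a)] 1) = low_el a (1 : {mpoly F[1]}).
    by rewrite (@Y_D1 m.+1 [::] 0 a 1) ?polyofK //= tofrac1.
  have inv_low a : borel_inv m.+1 (low_el a (1 : {mpoly F[1]})).
    by have [g gE gi] := @Y_poly m.+1 [:: (0%N, a)] 1 erefl; rewrite -low gE polyofK.
  have topE : top_el m.+1 (1 : {mpoly F[0]}) = low_el (qbracket q m.+1) 1.
    by rewrite /top_el /low_el qbracketK /poly_omit rmorph1.
  (* Without variables the invariants are the constants, in all truncations; the
     step from there to one variable gives the powers of D_1 up to [m+1]_q, the
     last of them first. *)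
  have := @basis_step F m 0 [:: 1] [:: (1, 1)].
  rewrite /calB /calB_idx -map_comp -map_comp.
  rewrite (eq_map (g := fun a => \pi_(Q m.+1 1) (low_el a 1))); last first.
    by move=> a /=; rewrite low.
  rewrite -[(qbracket q m.+1).+1]addn1 iotaD map_cat add0n /= topE => st.
  rewrite (perm_basis _ (introT permPl (perm_catC _ _))) /= -flatten_map1.
  apply: st.
  + by apply: basis_one; rewrite card_ffun !card_ord.
  + by apply: basis_one; rewrite card_ffun !card_ord.
  + by move=> z; rewrite inE => /eqP ->; rewrite expr1n /slice rmorph1 coef1.
  + by move=> y; rewrite inE => /eqP ->; rewrite topE.
  + by move=> a z _; rewrite inE => /eqP ->.
- rewrite /calB /= Y0_one polyofK; apply: basis_one.
  by rewrite card_ffun !card_ord exp1n.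
(* the elements of B_m(n), with their lifts by Phi *)
pose S2 := [seq (polyof (Yrec F m.+1 2 IJ n.+2), polyof (Y F m IJ n.+1)) |
             IJ <- calB_idx q m n.+1].
have S2P IJ : IJ \in calB_idx q m n.+1 -> exists f f', [/\ Y F m IJ n.+1 = f%:F,
    Yrec F m.+1 2 IJ n.+2 = f'%:F & frob_lift f' f].
  move=> /calB_idx_nvars[_ sz].
  have [f [f' [fE f'E _ _ rf]]] := @Yrec_poly F m IJ 0 n.+1 (esym sz).
  by exists f, f'.
have := @basis_step F m n.+1 (calB F m.+1 n.+1) S2 (IH m.+1).
have -> : [seq \pi_(Q m n.+1) z.2 | z <- S2] = [seq \pi_(Q m n.+1) p | p <- calB F m n.+1].
  by rewrite /S2 /calB -!map_comp.
move=> /(_ (IH m)); rewrite {3}/calB.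
have -> : calB_idx q m.+1 n.+2 = [seq delta1_idx IJ | IJ <- calB_idx q m.+1 n.+1] ++
  [seq D1_Phi_idx a IJ | a <- iota 0 (qbracket q m.+1), IJ <- calB_idx q m n.+1] by [].
have topE IJ : IJ \in calB_idx q m.+1 n.+1 ->
    polyof (Y F m.+1 (delta1_idx IJ) n.+2) = top_el m.+1 (polyof (Y F m.+1 IJ n.+1)).
  move=> /calB_idx_nvars[s0 sz]; have [f fE _] := @Y_poly m.+1 IJ n.+1 (esym sz).
  by rewrite fE (Y_delta1 s0 fE) !polyofK.
have lowE a IJ : IJ \in calB_idx q m n.+1 ->
    polyof (Y F m.+1 (D1_Phi_idx a IJ) n.+2) = low_el a (polyof (Yrec F m.+1 2 IJ n.+2)).
  by move=> /S2P[f [f' [_ f'E _]]]; rewrite (Y_D1 a f'E) f'E !polyofK.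
have invY IJ : (size IJ + sumn (unzip1 IJ))%N = n.+2 ->
    borel_inv m.+1 (polyof (Y F m.+1 IJ n.+2)).
  by move=> sz; have [f fE fi] := @Y_poly m.+1 IJ n.+2 (esym sz); rewrite fE polyofK.
rewrite {1}/calB -map_comp => st; rewrite map_cat map_cat -!map_comp.
have -> : [seq \pi_(Q m.+1 n.+2) (polyof (Y F m.+1 (delta1_idx IJ) n.+2)) |
             IJ <- calB_idx q m.+1 n.+1] =
    [seq \pi_(Q m.+1 n.+2) (top_el m.+1 (polyof (Y F m.+1 IJ n.+1))) |
       IJ <- calB_idx q m.+1 n.+1].
  by apply/eq_in_map => IJ IJB /=; rewrite topE.
rewrite map_allpairs (_ : [seq _ | a <- _, IJ <- _] =
    [seq \pi_(Q m.+1 n.+2) (low_el a z.1) |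
       a <- iota 0 (qbracket q m.+1), z <- S2]); last first.
  rewrite /S2 allpairs_mapr; apply/eq_in_allpairs => a IJ _ IJB /=.
  by rewrite lowE.
apply: st => [_ /mapP[IJ IJB ->]|_ /mapP[IJ IJB ->]|a _ aN /mapP[IJ IJB ->]] /=.
- have [f [f' [fE f'E rf]]] := S2P IJ IJB; rewrite fE f'E !polyofK slice0 rf //.
  by congr (_ ^+ q); rewrite -[RHS]ev_id; apply: eq_ev.
- rewrite -topE //; apply: invY; have [] := calB_idx_nvars IJB.
  by case: (IJ) => // -[i j] IJ' _ <- /=; lia.
- rewrite -lowE //; apply: invY; have [_ <-] := calB_idx_nvars IJB.
  by rewrite /= add0n addSn.
Qed.

End Final.

Theorem theorem1p6 (F : finFieldType) (n m : nat) (n_ge1 : (1 <= n)%N) :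
  basis_of (borel_invariants F m n)
    [seq \pi_(trunc_ring F m n) p | p <- calB F m n].
Proof. by case: n n_ge1 => // n _; apply: basis_calB. Qed.
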